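(* Let $\Omega\subset\mathbb{R}^d$ be a measurable set with $0<|\Omega|<+\infty$, let $\Lambda\subset\mathbb{R}^d$ be a full lattice with dual lattice $H$, and let $k$ be a positive integer. Suppose that (i) $\Omega$ submulti-tiles $\mathbb{R}^d$ at level $k$ by translations on $\Lambda$, and (ii) $\Omega$ is admissible for $\Lambda$. Then there exist $a_1,\dots,a_k\in\mathbb{R}^d$ such that $E(H;a_1,\dots,a_k)$ is a frame of $L^2(\Omega)$.
   Context: A full lattice in $\mathbb{R}^d$ is a set $\Lambda=M\mathbb{Z}^d$ with $M$ an invertible real $d\times d$ matrix; its fundamental domain is $D=M[0,1)^d$, and its dual lattice is $H=\{h\in\mathbb{R}^d:\langle h,\lambda\rangle\in\mathbb{Z}\text{ for all }\lambda\in\Lambda\}$. For $\Omega\subset\mathbb{R}^d$ and $\omega\in D$, put $\Lambda_\omega=\{\lambda\in\Lambda:\omega+\lambda\in\Omega\}$. $\Omega$ (measurable, of finite measure) submulti-tiles $\mathbb{R}^d$ at level $k$ by translations on $\Lambda$ if $\sum_{\lambda\in\Lambda}\chi_\Omega(\omega+\lambda)\le k$ for almost every $\omega\in D$. $\Omega$ (of finite measure) is admissible for $\Lambda$ if there exist $v\in H$ and a positive integer $n$ such that for almost every $\omega\in D$ the integers $\langle v,\lambda\rangle$, $\lambda\in\Lambda_\omega$, are pairwise distinct modulo $n$ (i.e. $\langle v,\lambda\rangle\not\equiv\langle v,\lambda'\rangle \pmod n$ for distinct $\lambda,\lambda'\in\Lambda_\omega$). $E(H;a_1,\dots,a_k)$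 is the system of functions $\omega\mapsto e^{2\pi i(a_j+h)\cdot\omega}$ (restricted to $\Omega$), regarded as a family indexed by $h\in H$, $j=1,\dots,k$. A countable family $\{f_\gamma\}_{\gamma\in\Gamma}$ in $L^2(\Omega)$ is a frame of $L^2(\Omega)$ if there are constants $A,B>0$ with $A\|f\|^2\le\sum_{\gamma}|\langle f,f_\gamma\rangle|^2\le B\|f\|^2$ for all $f\in L^2(\Omega)$. *)

(* Defs.v *)
From HB Require Import structures.
From mathcomp Require Import all_boot all_order all_algebra.
From mathcomp Require Import all_classical all_reals all_analysis.
From mathcomp Require Import complex.

Set Implicit Arguments.
Unset Strict Implicit.
Unset Printing Implicit Defensive.

Import Order.TTheory GRing.Theory Num.Theory.
Import numFieldNormedType.Exports.

Local Open Scope classical_set_scope.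
Local Open Scope ring_scope.

(* R^d is 'cV[R]_d, so that a lattice is M *m z for
   integral columns z. *)

Definition cV_display : measure_display -> measure_display.
Proof. exact. Qed.

Definition cV_coord (R : realType) (d : nat) (i : 'I_d) (x : 'cV[R]_d) :
  measurableTypeR R := x i ord0.

(* Borel sigma-algebra of R^d, generated by the coordinates (this is how the
   library equips d.-tuple T). *)
HB.instance Definition _ (R : realType) (d : nat) :=
  @isMeasurable.Build (cV_display default_measure_display) 'cV[R]_d
    (g_sigma_preimage (@cV_coord R d))
    (@sigma_algebra0 _ setT _) (@sigma_algebraC _ _)
    (@sigma_algebra_bigcup _ setT _).

Lemma measurable_cV_coord (R : realType) (d : nat) (i : 'I_d) :
  measurable_fun [set: 'cV[R]_d] (@cV_coord R d i).
Proof.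
move=> _ Y mY; rewrite setTI; apply: sub_sigma_algebra => /=.
rewrite -bigcup_seq/=; exists i => /=; first by rewrite mem_index_enum.
by exists Y => //; rewrite setTI.
Qed.

Lemma measurable_fun_cVP (R : realType) (d : nat) d' (T : measurableType d')
    (f : T -> 'cV[R]_d) :
  (forall i, measurable_fun [set: T] (@cV_coord R d i \o f)) ->
  measurable_fun [set: T] f.
Proof.
move=> mf _ A mA; rewrite setTI.
suff : g_sigma_preimage (@cV_coord R d) `<=` [set A | measurable (f @^-1` A)].
  exact.
apply: smallest_sub.
  split => /=; first by rewrite preimage_set0.
    by move=> B mB; rewrite setTD -[X in measurable X]/(~` (f @^-1` B));
      exact: measurableC.
  by move=> F mF; rewrite preimage_bigcup; exact: bigcupT_measurable.
rewrite -bigcup_seq/=; apply: bigcup_sub => i _ _ [Y mY <-] /=.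
have := mf i measurableT Y mY.
by rewrite !setTI.
Qed.

Definition cV_cons (R : realType) (d : nat) (p : measurableTypeR R * 'cV[R]_d) :
    'cV[R]_d.+1 :=
  \col_i oapp (fun j => p.2 j ord0) p.1 (unlift ord0 i).

Definition cV_uncons (R : realType) (d : nat) (x : 'cV[R]_d.+1) :
  measurableTypeR R * 'cV[R]_d :=
  (x ord0 ord0, \col_i x (lift ord0 i) ord0).

Lemma cV_consK (R : realType) (d : nat) :
  cancel (@cV_cons R d) (@cV_uncons R d).
Proof.
move=> [x v]; rewrite /cV_uncons; congr pair; first by rewrite mxE unlift_none.
by apply/matrixP => i j; rewrite (ord1 j) !mxE liftK.
Qed.

Lemma cV_unconsK (R : realType) (d : nat) :
  cancel (@cV_uncons R d) (@cV_cons R d).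
Proof.
move=> x; apply/matrixP => i j; rewrite (ord1 j) mxE.
by case: unliftP => [k ->|->] /=; rewrite ?mxE.
Qed.

Lemma measurable_cV_cons (R : realType) (d : nat) :
  measurable_fun setT (@cV_cons R d).
Proof.
apply: measurable_fun_cVP => i.
case: (unliftP ord0 i) => [j ->|->].
  rewrite (_ : _ \o _ = (@cV_coord R d j) \o snd); last first.
    by apply/funext => p /=; rewrite /cV_coord mxE liftK.
  apply: measurableT_comp; last exact: measurable_snd.
  exact: measurable_cV_coord.
rewrite (_ : _ \o _ = fst); first exact: measurable_fst.
by apply/funext => p /=; rewrite /cV_coord mxE unlift_none.
Qed.

Lemma measurable_cV_uncons (R : realType) (d : nat) :
  measurable_fun setT (@cV_uncons R d).
Proof.
apply/measurable_fun_pairP; split.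
  exact: (measurable_cV_coord (ord0 : 'I_d.+1)).
apply: measurable_fun_cVP => i.
rewrite (_ : _ \o _ = @cV_coord R d.+1 (lift ord0 i)).
  exact: measurable_cV_coord.
by apply/funext => x; rewrite /cV_coord /= mxE.
Qed.

Section cV_cons_measure.
Local Open Scope ereal_scope.
Context (R : realType) (d : nat).
Variable m : {sigma_finite_measure set 'cV[R]_d -> \bar R}.

(* Product of the Lebesgue measure on the line with m, carried to R^(d+1). *)
Definition cV_cons_measure : set 'cV[R]_d.+1 -> \bar R :=
  pushforward (@lebesgue_measure R \x m) (@cV_cons R d).

Let cV_cons_measure0 : cV_cons_measure set0 = 0.
Proof. by rewrite /cV_cons_measure /pushforward preimage_set0 measure0. Qed.

Let cV_cons_measure_ge0 A : 0 <= cV_cons_measure A.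
Proof. by rewrite /cV_cons_measure /pushforward. Qed.

Let cV_cons_measure_sigma_additive : semi_sigma_additive cV_cons_measure.
Proof.
move=> F mF tF mUF; rewrite /cV_cons_measure /pushforward preimage_bigcup.
have mp i : measurable (@cV_cons R d @^-1` F i).
  by rewrite -[X in measurable X]setTI; exact: measurable_cV_cons.
apply: measure_semi_sigma_additive => //; last exact: bigcupT_measurable.
apply/trivIsetP => /= i j _ _ ij; rewrite -preimage_setI.
by move/trivIsetP : tF => /(_ _ _ _ _ ij) ->//; rewrite preimage_set0.
Qed.

HB.instance Definition _ := isMeasure.Build _ _ _ cV_cons_measure
  cV_cons_measure0 cV_cons_measure_ge0 cV_cons_measure_sigma_additive.

Let cV_cons_measure_sigma_finite : sigma_finite setT cV_cons_measure.
Proof.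
have /sigma_finiteP[F [TF ndF Foo]] := sigma_finiteT (@lebesgue_measure R).
have /sigma_finiteP[G [TG ndG Goo]] := sigma_finiteT m.
exists (fun n => @cV_uncons R d @^-1` (F n `*` G n)).
  rewrite -preimage_bigcup (_ : \bigcup_n (F n `*` G n) = setT) ?preimage_setT//.
  rewrite -setXTT TF TG predeqE => -[x y]; split.
    by move=> [n _ []/= ? ?]; split; exists n.
  move=> [/= [n _ Fnx] [k _ Gky]]; exists (maxn n k) => //; split.
  - by move: x Fnx; exact/subsetPset/ndF/leq_maxl.
  - by move: y Gky; exact/subsetPset/ndG/leq_maxr.
move=> n; have [? ?] := Foo n; have [? ?] := Goo n; split.
  by rewrite -[X in measurable X]setTI; apply: measurable_cV_uncons => //;
    exact: measurableX.
rewrite /cV_cons_measure /pushforward -comp_preimage.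
rewrite (_ : _ \o _ = id) ?preimage_id; last by apply/funext; exact: cV_consK.
by rewrite product_measure1E// lte_mul_pinfty// ge0_fin_numE.
Qed.

HB.instance Definition _ := @Measure_isSigmaFinite.Build _ _ _
  cV_cons_measure cV_cons_measure_sigma_finite.

End cV_cons_measure.

(* d-fold product of the Lebesgue measure on the line, on Borel sets. *)
Fixpoint borel_lebesgue (R : realType) (d : nat) :
    {sigma_finite_measure set 'cV[R]_d -> \bar R} :=
  match d with
  | 0%N => \d_(0 : 'cV[R]_0)
  | d'.+1 => cV_cons_measure (borel_lebesgue R d')
  end.

(* R^d with its Lebesgue (completed, i.e. Caratheodory) sigma-algebra. *)
Definition Rd (R : realType) (d : nat) :=
  caratheodory_type (mu_ext (borel_lebesgue R d)).
HB.instance Definition _ (R : realType) (d : nat) := Measurable.on (Rd R d).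

Definition lebesgue (R : realType) (d : nat) : set (Rd R d) -> \bar R :=
  @completed_measure_extension _ _ _ (borel_lebesgue R d).
HB.instance Definition _ (R : realType) (d : nat) :=
  Measure.on (@lebesgue R d).
Arguments lebesgue R d : clear implicits.

Definition lebesgue_measurable (R : realType) (d : nat) (A : set 'cV[R]_d) :=
  measurable (A : set (Rd R d)).

Lemma borel_lebesgue_measurable (R : realType) (d : nat) (A : set 'cV[R]_d) :
  measurable A -> lebesgue_measurable A.
Proof. by move=> mA; apply: sub_caratheodory; apply: sub_sigma_algebra. Qed.

Lemma lebesgue_borel (R : realType) (d : nat) (A : set 'cV[R]_d) :
  measurable A -> lebesgue R d A = borel_lebesgue R d A.
Proof.
by move=> mA; rewrite /lebesgue /completed_measure_extension measurable_mu_extE.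
Qed.

Definition box (R : realType) (d : nat) (a b : 'I_d -> R) : set 'cV[R]_d :=
  [set x | forall i, a i <= x i ord0 < b i].

Lemma measurable_box (R : realType) (d : nat) (a b : 'I_d -> R) :
  measurable (box a b).
Proof.
rewrite (_ : box a b =
    \big[setI/setT]_(i < d) (@cV_coord R d i @^-1` [set` `[a i, b i[])).
  apply: bigsetI_measurable => i _; rewrite -[X in measurable X]setTI.
  by apply: measurable_cV_coord => //; exact: measurable_itv.
apply/seteqP; split => x /=.
  by move=> h; rewrite -bigcap_seq => i /= _; rewrite in_itv /=; exact: h.
rewrite -bigcap_seq => h i; have := h i; rewrite /= in_itv/=; apply.
by rewrite mem_index_enum.
Qed.

Lemma borel_lebesgue_box (R : realType) (d : nat) (a b : 'I_d -> R) :
  (forall i, a i <= b i) ->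
  borel_lebesgue R d (box a b) = (\prod_(i < d) (b i - a i))%:E.
Proof.
elim: d a b => [|d IH] a b ab.
  by rewrite big_ord0 /= diracE mem_set //= => -[].
rewrite /= /cV_cons_measure /pushforward.
rewrite (_ : _ @^-1` _ =
    [set` `[a ord0, b ord0[] `*` box (a \o lift ord0) (b \o lift ord0)).
  rewrite product_measure1E; [|exact: measurable_itv|exact: measurable_box].
  rewrite IH; last by move=> i /=.
  rewrite big_ord_recl EFinM; congr (_ * _)%E.
  transitivity (@lebesgue_measure R [set` `[a ord0, b ord0[]) => //.
  rewrite lebesgue_measure_itv /= lte_fin.
  have := ab ord0; rewrite le_eqVlt.
  by move=> /predU1P[->|->]; rewrite ?ltxx ?subrr ?EFinB.
apply/seteqP; split => -[x v]; rewrite /box /= in_itv /=.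
  move=> h; split; first by have := h ord0; rewrite mxE unlift_none.
  by move=> i; have := h (lift ord0 i); rewrite mxE liftK.
move=> [h1 h2] i; rewrite mxE; case: unliftP => [j ->|->] //=; exact: h2.
Qed.

Lemma lebesgue_box (R : realType) (d : nat) (a b : 'I_d -> R) :
  (forall i, a i <= b i) ->
  lebesgue R d (box a b) = (\prod_(i < d) (b i - a i))%:E.
Proof.
move=> ab; rewrite lebesgue_borel; first exact: borel_lebesgue_box.
exact: measurable_box.
Qed.

Definition inner (R : realType) (d : nat) (x y : 'cV[R]_d) : R :=
  \sum_(i < d) x i ord0 * y i ord0.

(* The lattice M Z^d. *)
Definition lattice (R : realType) (d : nat) (M : 'M[R]_d) : set 'cV[R]_d :=
  [set M *m map_mx intr z | z in [set: 'cV[int]_d]].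

(* M [0,1)^d *)
Definition fundamental_domain (R : realType) (d : nat) (M : 'M[R]_d) :
    set 'cV[R]_d :=
  [set M *m t | t in [set t : 'cV[R]_d | forall i, 0 <= t i ord0 < 1]].

Definition dual_lattice (R : realType) (d : nat) (L : set 'cV[R]_d) :
    set 'cV[R]_d :=
  [set h | forall l, L l -> inner h l \is a Num.int].

(* The set Lambda_omega. *)
Definition lattice_fiber (R : realType) (d : nat) (L Omega : set 'cV[R]_d)
    (w : 'cV[R]_d) : set 'cV[R]_d :=
  [set l | L l /\ Omega (w + l)].

Definition submulti_tiles (R : realType) (d : nat) (M : 'M[R]_d)
    (Omega : set 'cV[R]_d) (k : nat) : Prop :=
  {ae lebesgue R d, forall w, fundamental_domain M w ->
    (\esum_(l in lattice M) (\1_Omega (w + l) : R)%:E <= (k%:R : R)%:E)%E}.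

(* For v in the dual lattice the values inner v l below are integers, so the
   real numbers are compared modulo n through their integer values p and q. *)
Definition admissible (R : realType) (d : nat) (M : 'M[R]_d)
    (Omega : set 'cV[R]_d) : Prop :=
  exists (v : 'cV[R]_d) (n : nat),
    [/\ dual_lattice (lattice M) v, (0 < n)%N &
      {ae lebesgue R d, forall w, fundamental_domain M w ->
        forall l l',
          lattice_fiber (lattice M) Omega w l ->
          lattice_fiber (lattice M) Omega w l' ->
          l <> l' ->
          forall p q : int, inner v l = p%:~R -> inner v l' = q%:~R ->
            (p <> q %[mod n%:Z])%Z}].

(* An element of L^2(Omega) is represented by a complex function on R^d, of
   which only the values on Omega matter. *)
Definition L2 (R : realType) (d : nat) (Omega : set 'cV[R]_d)
    (f : 'cV[R]_d -> R[i]) : Prop :=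
  [/\ measurable_fun (Omega : set (Rd R d)) (fun x : Rd R d => complex.Re (f x)),
      measurable_fun (Omega : set (Rd R d)) (fun x : Rd R d => complex.Im (f x)) &
      (\int[lebesgue R d]_(x in Omega) (Normc.normc (f x) ^+ 2)%:E < +oo)%E].

Definition L2norm2 (R : realType) (d : nat) (Omega : set 'cV[R]_d)
    (f : 'cV[R]_d -> R[i]) : \bar R :=
  (\int[lebesgue R d]_(x in Omega) (Normc.normc (f x) ^+ 2)%:E)%E.

Definition L2inner (R : realType) (d : nat) (Omega : set 'cV[R]_d)
    (f g : 'cV[R]_d -> R[i]) : R[i] :=
  Complex
    (\int[lebesgue R d]_(x in Omega) complex.Re (f x * conjc (g x)))
    (\int[lebesgue R d]_(x in Omega) complex.Im (f x * conjc (g x))).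

(* The family (F i) indexed by i in S is a frame of L^2(Omega). *)
Definition is_frame (R : realType) (d : nat) (Omega : set 'cV[R]_d)
    (I : choiceType) (S : set I) (F : I -> 'cV[R]_d -> R[i]) : Prop :=
  [/\ countable S,
      (forall i, S i -> L2 Omega (F i)) &
      exists A B : R, [/\ 0 < A, 0 < B &
        forall f, L2 Omega f ->
          (A%:E * L2norm2 Omega f
             <= \esum_(i in S) (Normc.normc (L2inner Omega f (F i)) ^+ 2)%:E
             <= B%:E * L2norm2 Omega f)%E]].

(* omega |-> exp(2 pi i a.omega) *)
Definition character (R : realType) (d : nat) (a w : 'cV[R]_d) : R[i] :=
  Complex (cos (2 * pi * inner a w)) (sin (2 * pi * inner a w)).

(* The system E(H; a_1, ..., a_k), as a family indexed by H x {1, ..., k}. *)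
Definition exp_system (R : realType) (d k : nat) (a : 'I_k -> 'cV[R]_d)
    (hj : 'cV[R]_d * 'I_k) : 'cV[R]_d -> R[i] :=
  character (a hj.2 + hj.1).

(* Main.v *)
Require Import Defs.
From HB Require Import structures.
From mathcomp Require Import all_boot all_order all_algebra.
From mathcomp Require Import all_classical all_reals all_analysis.
From mathcomp Require Import measurable_realfun complex ring lra.

Set Implicit Arguments.
Unset Strict Implicit.
Unset Printing Implicit Defensive.

Import Order.TTheory GRing.Theory Num.Theory.
Import numFieldNormedType.Exports.

Local Open Scope classical_set_scope.
Local Open Scope ring_scope.

(* Let v, n witness admissibility and take a_j = (j / n) v. Integrals over R^d
   fold onto the fundamental domain D, so the coefficient of f at a_j + h is the
   h-th Fourier coefficient on D of the fibre sum
     F_j(w) = sum_l f(w + l) z_l^j,  z_l = exp(-2 pi i <v, w + l> / n),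
   over the at most k points l of the fibre of w. By Parseval on D the frame sum
   is |D| times the integral of sum_j |F_j|^2. Since the z_l differ by distinct
   n-th roots of unity, they are uniformly separated, and a Vandermonde estimate
   bounds sum_j |F_j|^2 above and below by sum_l |f(w + l)|^2, whose integral
   over D is the squared norm of f. *)

(** Folding needs integrable functions: an L^2 function on [Omega], extended by zero, is integrable
    because [Omega] has finite measure. That the fibre sums F_j are square integrable is not clear
    beforehand; it is read off from the upper Vandermonde bound before Parseval is applied. The
    Vandermonde constants must not vary with the fibre: they depend only on k and on a gap between
    the points z_l, and admissibility gives a gap depending only on n, since the ratios z_l / z_l'
    take finitely many values, all different from 1. Parseval on D needs completeness of the
    exponentials for Lebesgue measurable functions. It is obtained by a measure argument: the sets
    whose indicator is an L^2(D)-limit of trigonometric polynomials form a sigma-algebra; they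
    include every set p < 0 with p a trigonometric polynomial; signs of sines cut out half-spaces in
    lattice coordinates, which generate the Borel sets; Lebesgue sets follow by outer approximation.
    Orthogonality needs no iterated integral: a half-period translation turns every nonconstant mode
    into its negative. *)

Section invariant_integral.
Local Open Scope ereal_scope.
Context d (T : measurableType d) (R : realType).
Variables (mu : {measure set T -> \bar R}) (phi : T -> T).
Hypothesis mphi : measurable_fun setT phi.
Hypothesis phi_mu : forall A, measurable A -> mu (phi @^-1` A) = mu A.

(** Change of variables: the pushforward of [mu] under [phi] agrees with [mu] on measurable sets. *)
Lemma ge0_integral_preimage (D : set T) (f : T -> \bar R) :
  measurable D -> measurable_fun D f -> {in D, forall y, 0 <= f y} ->
  \int[mu]_(x in phi @^-1` D) f (phi x) = \int[mu]_(x in D) f x.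
Proof.
move=> mD mf f0; rewrite -ge0_integral_pushforward //.
pose mphi_mixin := isMeasurableFun.Build _ _ _ _ _ mphi.
pose mphi_pack : {mfun _ >-> _} := HB.pack phi mphi_mixin.
apply: (@eq_measure_integral _ _ _ D mu (pushforward mu mphi_pack)).
by move=> A mA _; exact: phi_mu.
Qed.

End invariant_integral.

(** * Translation invariance of Lebesgue measure on R^d *)

Section translation.
Context (R : realType).

Lemma measurable_cV_addr d (v : 'cV[R]_d) :
  measurable_fun setT (fun x : 'cV[R]_d => x + v).
Proof.
apply: measurable_fun_cVP => i.
rewrite (_ : _ \o _ = (fun x => cV_coord i x + v i ord0 : R)).
  by apply: measurable_funD => //; exact: measurable_cV_coord.
by apply/funext => x; rewrite /cV_coord /= mxE.
Qed.

(** By uniqueness of Lebesgue measure it is enough to compare the two measures on half-open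
    intervals. *)
Lemma lebesgue_measure_addr (a : R) (A : set (measurableTypeR R)) :
  measurable A ->
  lebesgue_measure ((fun x : measurableTypeR R => x + a : measurableTypeR R) @^-1` A)
  = lebesgue_measure A :> \bar R.
Proof.
move=> mA; apply/esym.
pose phi := (fun x : measurableTypeR R => x + a : measurableTypeR R).
have mphi : measurable_fun setT phi by exact: measurable_funD.
pose mphi_mixin := isMeasurableFun.Build _ _ _ _ _ mphi.
pose mphi_pack : {mfun _ >-> _} := HB.pack phi mphi_mixin.
apply: (@lebesgue_measure_unique R (pushforward lebesgue_measure mphi_pack)) => //.
move=> _ [[x y] _ <-] /=; rewrite /pushforward /=.
rewrite (_ : phi @^-1` _ = `]x - a, y - a]%classic); last first.
  by apply/seteqP; split=> z; rewrite /phi /= !in_itv /= ltrBlDr lerBrDr.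
rewrite !lebesgue_measure_itv /= !lte_fin ltrD2r.
by case: ifP => // _; rewrite -!EFinB; congr (_%:E); ring.
Qed.

(** Induction on the dimension through sections: the tail of [v] moves each slice, which is the
    induction hypothesis, and its first coordinate moves the variable of the outer integral. *)
Lemma borel_lebesgue_addr d (v : 'cV[R]_d) (A : set 'cV[R]_d) :
  measurable A ->
  borel_lebesgue R d ((fun x => x + v) @^-1` A) = borel_lebesgue R d A.
Proof.
elim: d v A => [|d IH] v A mA.
  by apply: (congr1 (borel_lebesgue R 0)); apply/seteqP; split=> x;
    rewrite /= (flatmx0 v) addr0.
rewrite /= /cV_cons_measure /pushforward.
set B := @cV_cons R d @^-1` A.
have mB : measurable B.
  by rewrite -[X in measurable X]setTI; exact: measurable_cV_cons.
pose w : 'cV[R]_d := \col_i v (lift ord0 i) ord0.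
pose psi (x : measurableTypeR R) : measurableTypeR R := x + v ord0 ord0.
have mpsi : measurable_fun setT psi by exact: measurable_funD.
transitivity (\int[@lebesgue_measure R]_x borel_lebesgue R d (xsection B (psi x)))%E.
  apply: eq_integral => x _ /=.
  rewrite -[RHS](IH w); last exact: measurable_xsection.
  apply: (congr1 (borel_lebesgue R d)); apply/seteqP.
  suff E y : cV_cons (x, y) + v = cV_cons (psi x, y + w).
    by split => y; rewrite /xsection /= !inE /B /= E.
  apply/matrixP => i j; rewrite (ord1 j) !mxE /=.
  by case: unliftP => [k ->|->] //=; rewrite !mxE.
pose F (x : measurableTypeR R) := borel_lebesgue R d (xsection B x).
have := @ge0_integral_preimage _ _ _ (@lebesgue_measure R) psi mpsi
  (@lebesgue_measure_addr _) setT F measurableT.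
rewrite preimage_setT; apply => //.
exact: measurable_fun_xsection.
Qed.

Local Notation mu_ext_d d := (mu_ext (borel_lebesgue R d)).

(** A countable Borel cover of [B] translates to one of the translate of [B], with the same total
    measure. This gives one inequality for every vector; applied to the opposite vector it gives the
    other. *)
Lemma mu_ext_addr d (v : 'cV[R]_d) (A : set 'cV[R]_d) :
  mu_ext_d d ((fun x => x + v) @^-1` A) = mu_ext_d d A.
Proof.
have le (B : set ('cV[R]_d)) w : (mu_ext_d d ((fun x => (x + w)%R) @^-1` B) <= mu_ext_d d B)%E.
  apply: le_ereal_inf_tmp => _ [F [mF BF] <-].
  apply: ereal_inf_lbound; exists (fun n => (fun x => (x + w)%R) @^-1` F n).
    split => [n|x /= /BF[n _ Fn]]; last by exists n.
    by rewrite -[X in measurable X]setTI; exact: measurable_cV_addr.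
  by apply: eq_eseriesr => n _; rewrite borel_lebesgue_addr.
apply/eqP; rewrite eq_le le /=.
have -> : A = (fun x => x - v) @^-1` ((fun x => x + v) @^-1` A).
  by apply/seteqP; split => x /=; rewrite subrK.
rewrite (le_trans (le _ _))//; apply: le_mu_ext => x /=.
by rewrite subrK.
Qed.

(** Caratheodory's criterion mentions the outer measure only, and that is translation invariant.
    Borel measurability of the translation would not be enough here, as the target carries the
    completed sigma-algebra. *)
Lemma measurable_Rd_addr d (v : 'cV[R]_d) :
  measurable_fun setT (fun x : Rd R d => (x : 'cV[R]_d) + v : Rd R d).
Proof.
move=> _ A mA; rewrite setTI.
have {}mA : caratheodory_measurable (mu_ext_d d) A := mA.
rewrite -[measurable _]/(caratheodory_measurable (mu_ext_d d)
  ((fun x : 'cV[R]_d => x + v) @^-1` A)) => X.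
set t := (fun x => x + v).
have K (Y : set 'cV[R]_d) : t @^-1` ((fun x => x - v) @^-1` Y) = Y.
  by apply/seteqP; split => x; rewrite /t /= addrK.
rewrite -[X]K preimage_setC -!preimage_setI.
have H Y : mu_ext_d d (t @^-1` Y) = mu_ext_d d Y by exact: mu_ext_addr.
by rewrite !H; exact: mA.
Qed.

Lemma lebesgue_addr d (v : 'cV[R]_d) (A : set (Rd R d)) :
  lebesgue R d ((fun x : Rd R d => (x : 'cV[R]_d) + v : Rd R d) @^-1` A) =
  lebesgue R d A.
Proof. exact: mu_ext_addr. Qed.

End translation.

(** * Countable sums of nonnegative functions and their integrals *)

Section esum_count.
Local Open Scope ereal_scope.
Context (R : realType) (I : countType).

(** Turns a sum over a countable type into a series over the naturals, padded with 0 at numbers that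
    code no index, so that measurability and monotone convergence for series apply. *)
Lemma esum_pickle (a : I -> \bar R) : (forall i, 0 <= a i) ->
  \esum_(i in setT) a i = \sum_(n <oo) oapp a 0 (pickle_inv n).
Proof.
move=> a0; rewrite nneseries_esumT => [|n]; last by case: pickle_inv => /=.
transitivity (\esum_(n in range (@pickle I)) oapp a 0 (pickle_inv n)).
  rewrite (@reindex_esum _ I nat setT _ pickle) //.
    apply: eq_esum => i _.
    by rewrite /= pickleK_inv.
  by apply: inj_bij => x y _ _; exact: (pcan_inj pickleK_inv).
rewrite esum_mkcond; apply: eq_esum => n _.
case: ifPn => // /negP nr; case E : (pickle_inv n) => [i|] //=.
exfalso; apply: nr; rewrite inE; exists i => //.
by have := @pickle_invK I n; rewrite E /=.
Qed.

Lemma esum_point (a : I -> \bar R) (i : I) : (forall j, 0 <= a j) ->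
  (forall j, j <> i -> a j = 0) -> \esum_(j in setT) a j = a i.
Proof.
move=> a0 aN; rewrite -(esum_set1 (a0 i)) [RHS]esum_mkcond.
apply: eq_esum => j _; case: ifPn => //; rewrite notin_setE /= => /aN //.
Qed.

Lemma esumZl (c : R) (a : I -> \bar R) : (0 <= c)%R -> (forall i, 0 <= a i) ->
  \esum_(i in setT) (c%:E * a i) = c%:E * \esum_(i in setT) a i.
Proof.
move=> c0 a0; rewrite !esum_pickle //; last by move=> i; rewrite mule_ge0 ?lee_fin.
rewrite -nneseriesZl ?lee_fin //; last by move=> n _; case: pickle_inv => /=.
by apply: eq_eseriesr => n _; case: pickle_inv => //=; rewrite mule0.
Qed.

Lemma esum_seq (a : I -> \bar R) (s : seq I) : uniq s -> (forall i, 0 <= a i) ->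
  (forall i, i \notin s -> a i = 0) ->
  \esum_(i in setT) a i = \sum_(i <- s) a i.
Proof.
move=> us a0 aN; rewrite [RHS]fsbig_seq // -esum_fset //.
rewrite [RHS]esum_mkcond; apply: eq_esum => i _.
by case: ifPn => //; rewrite notin_setE => /negP/aN.
Qed.

Context d (T : measurableType d) (mu : {measure set T -> \bar R}).

Lemma measurable_fun_esum (D : set T) (f : I -> T -> \bar R) :
  (forall i, measurable_fun D (f i)) -> (forall i x, 0 <= f i x) ->
  measurable_fun D (fun x => \esum_(i in setT) f i x).
Proof.
move=> mf f0.
rewrite (_ : (fun x => _) =
    fun x => \sum_(n <oo) oapp (f^~ x) 0 (pickle_inv n)); last first.
  by apply/funext => x; rewrite esum_pickle.
apply: ge0_emeasurable_sum => [n x _ _|n _]; first by case: pickle_inv => /=.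
by case: pickle_inv => [i|] /=; [exact: mf|exact: measurable_cst].
Qed.

Lemma integral_esum (D : set T) (f : I -> T -> \bar R) : measurable D ->
  (forall i, measurable_fun D (f i)) -> (forall i x, 0 <= f i x) ->
  \int[mu]_(x in D) (\esum_(i in setT) f i x) =
  \esum_(i in setT) \int[mu]_(x in D) f i x.
Proof.
move=> mD mf f0; rewrite esum_pickle; last by move=> i; exact: integral_ge0.
under eq_integral do rewrite esum_pickle //.
rewrite integral_nneseries //.
- by apply: eq_eseriesr => n _; case: pickle_inv => //=; rewrite integral0.
- by move=> n; case: pickle_inv => [i|] /=; [exact: mf|exact: measurable_cst].
- by move=> n x _; case: pickle_inv => /=.
Qed.

End esum_count.

(** * Folding integrals onto a fundamental domain of a countable family of transformations *)

Section fold.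
Context d (T : measurableType d) (R : realType) (I : countType).
Variables (mu : {measure set T -> \bar R}) (tau : I -> T -> T) (opp : I -> I).
Hypothesis mtau : forall i, measurable_fun setT (tau i).
Hypothesis tau_mu : forall i A, measurable A -> mu (tau i @^-1` A) = mu A.
Hypothesis oppK : involutive opp.
Hypothesis tauK : forall i x, tau (opp i) (tau i x) = x.
Variable D : set T.
Hypothesis mD : measurable D.
Hypothesis D_ex : forall x, exists i, D (tau i x).
Hypothesis D_uniq : forall x i j, D (tau i x) -> D (tau j x) -> i = j.

(** Exactly one index i sends x into [D], so U x is the sum over i of U x restricted to the event
    that [tau i x] lies in [D]. Exchange sum and integral, and use the invariance of [mu] under each
    [tau i]. *)
Lemma integral_fold (U : T -> \bar R) : measurable_fun setT U ->
  (forall x, 0 <= U x)%E ->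
  (\int[mu]_x U x = \int[mu]_(x in D) (\esum_(i in setT) U (tau i x)))%E.
Proof.
move=> mU U0.
have mUt i : measurable_fun setT (U \o tau i) by exact: measurableT_comp.
pose V i x := ((U \o tau (opp i)) \_ D) x.
have V0 i x : (0 <= V i x)%E by apply: erestrict_ge0 => y _; exact: U0.
have mV i : measurable_fun setT (V i).
  apply/(measurable_restrictT _ mD) => //; exact: measurable_funS (mUt _).
transitivity (\int[mu]_x (\esum_(i in setT) V i (tau i x)))%E.
  apply: eq_integral => x _; have [i Di] := D_ex x.
  rewrite (esum_point (i := i)) // /V ?patchE.
    by rewrite mem_set //= tauK.
  move=> j ji; rewrite patchE ifN // notin_setE => Dj; apply: ji.
  exact: D_uniq Dj Di.
rewrite integral_esum //; last by move=> i; exact: measurableT_comp.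
rewrite integral_esum //; last by move=> i; exact: measurable_funS (mUt _).
rewrite (@reindex_esum _ _ _ setT setT opp); last first.
  split => [|i j _ _ ij|i _] //; [by rewrite -(oppK i) ij oppK|by exists (opp i)].
apply: eq_esum => i _.
have := @ge0_integral_preimage _ _ _ mu _ (mtau (opp i)) (tau_mu (opp i)) setT
  (V (opp i)) measurableT (mV _) (fun x _ => V0 _ x).
rewrite preimage_setT => ->; rewrite /V oppK -integral_mkcond.
by [].
Qed.

Definition pos_fold (u : T -> R) (x : T) : \bar R :=
  (\esum_(i in [set: I]) (Num.max (u (tau i x)) 0)%:E)%E.

(** The sum of [u] over an orbit, as a total real function: positive and negative parts are summed
    separately in the extended reals, and [fine] replaces an infinite sum by 0. For integrable [u]
    this happens only on a null subset of [D]. *)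
Definition fold (u : T -> R) (x : T) : R :=
  fine (pos_fold u x) - fine (pos_fold (fun y => - u y) x).

Lemma pos_fold_ge0 u x : (0 <= pos_fold u x)%E.
Proof. by apply: esum_ge0 => i _; rewrite lee_fin le_max lexx orbT. Qed.

Lemma measurable_pos_fold u : measurable_fun setT u ->
  measurable_fun setT (pos_fold u).
Proof.
move=> mu_; apply: measurable_fun_esum => [i|i x]; last first.
  by rewrite lee_fin le_max lexx orbT.
apply/measurable_EFinP.
have mc : measurable_fun setT (fun y => Num.max (u y) 0).
  by apply: measurable_maxr => //; exact: measurable_cst.
exact: (measurableT_comp mc (mtau i)).
Qed.

Lemma measurable_fold u : measurable_fun setT u -> measurable_fun setT (fold u).
Proof.
move=> mu_; apply: measurable_funB.
  apply: (measurableT_comp _ (measurable_pos_fold mu_)).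
  exact: fine_measurable.
apply: (@measurableT_comp _ _ _ _ _ _ fine); first exact: fine_measurable.
by apply: measurable_pos_fold; exact: measurableT_comp.
Qed.

Lemma integral_pos_fold u : measurable_fun setT u ->
  (\int[mu]_(x in D) pos_fold u x = \int[mu]_x (EFin \o u)^\+ x)%E.
Proof.
move=> mu_; rewrite integral_fold //.
- apply: eq_integral => x _; apply: eq_esum => i _.
  by rewrite funeposE /= EFin_max.
- by apply: measurable_funepos; exact/measurable_EFinP.
Qed.

(** The orbit sum of the positive part has the finite integral of that part, hence is finite almost
    everywhere on [D], where [fine] loses nothing. The same holds for the negative part, and the two
    are subtracted. *)
Lemma fold_integrable u : mu.-integrable setT (EFin \o u) ->
  mu.-integrable D (EFin \o fold u) /\
  \int[mu]_(x in D) fold u x = \int[mu]_x u x.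
Proof.
move=> iu; have mu_ : measurable_fun setT u.
  by apply/measurable_EFinP; exact: measurable_int iu.
have H (v : T -> R) : mu.-integrable setT (EFin \o v) ->
    mu.-integrable D (EFin \o (fine \o pos_fold v)) /\
    (\int[mu]_(x in D) (fine (pos_fold v x))%:E = \int[mu]_x (EFin \o v)^\+ x)%E.
  move=> iv; have mv : measurable_fun setT v.
    by apply/measurable_EFinP; exact: measurable_int iv.
  have mp : measurable_fun D (pos_fold v).
    by apply: measurable_funS (measurable_pos_fold mv).
  have ip : mu.-integrable D (pos_fold v).
    apply/integrableP; split => //.
    under eq_integral do rewrite gee0_abs ?pos_fold_ge0 //.
    rewrite integral_pos_fold //; exact: integral_funepos_lt_pinfty.
  have mf : measurable_fun D (EFin \o (fine \o pos_fold v)).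
    apply/measurable_EFinP; apply: (@measurableT_comp _ _ _ _ _ _ fine) => //.
  have ae : ae_eq mu D (EFin \o (fine \o pos_fold v)) (pos_fold v).
    have [N [mN N0 sub]] := integrable_ae mD ip.
    by exists N; split => // x /= nx; apply: sub => /= fx; apply: nx => Dx /=;
      rewrite fineK // fx.
  split; last by rewrite -integral_pos_fold //; apply: ae_eq_integral.
  apply: (le_integrable mD mf _ ip) => x Dx.
  by rewrite /=; case: (pos_fold v x) => [r| |] //=; rewrite normr0 ?leey.
have [i1 e1] := H _ iu.
have iN : mu.-integrable setT (EFin \o (fun y => - u y)).
  rewrite (_ : EFin \o _ = -%E \o (EFin \o u)); last exact/funext.
  exact: integrableN.
have [i2 e2] := H _ iN.
split.
  by apply: eq_integrable (integrableB mD i1 i2).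
rewrite RintegralB // /Rintegral e1 e2.
rewrite [in RHS]integralE.
rewrite (_ : ((EFin \o (fun y => - u y)%R)^\+ = (EFin \o u)^\-)%E).
  rewrite -fineB //; first exact: (integrable_pos_fin_num measurableT iu).
  exact: (integrable_neg_fin_num measurableT iu).
by rewrite -funeposN; congr (_ ^\+)%E; apply/funext.
Qed.

Lemma pos_foldZ (c : R) u x : 0 <= c ->
  pos_fold (fun y => c * u y) x = (c%:E * pos_fold u x)%E.
Proof.
move=> c0; rewrite /pos_fold -esumZl // => [|i]; last first.
  by rewrite lee_fin le_max lexx orbT.
by apply: eq_esum => i _; rewrite -EFinM maxr_pMr // mulr0.
Qed.

Lemma foldZ (c : R) u x : fold (fun y => c * u y) x = c * fold u x.
Proof.
(* This holds at the infinities too: there both sides are 0. *)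
rewrite /fold; have fM b (e : \bar R) : fine (b%:E * e)%E = b * fine e.
  case: e => [r| |] //=; rewrite mulr0.
    by rewrite mulry; case: (sgrP b) => //= _; rewrite ?mul1e ?mulN1e ?mul0e.
  by rewrite mulrNy; case: (sgrP b) => //= _; rewrite ?mul1e ?mulN1e ?mul0e.
have [c0|/ltW c0] := leP 0 c.
  under [X in _ - fine (pos_fold X _)]eq_fun do rewrite -mulrN.
  by rewrite !pos_foldZ // !fM mulrBr.
rewrite (_ : (fun y => c * u y) = (fun y => - c * - u y)); last first.
  by apply/funext => y; rewrite mulrNN.
rewrite (_ : (fun y => - (c * u y)) = (fun y => - c * u y)); last first.
  by apply/funext => y; rewrite mulNr.
rewrite !pos_foldZ ?oppr_ge0 // !fM; ring.
Qed.

Lemma foldM (phi u : T -> R) x : (forall i y, phi (tau i y) = phi y) ->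
  fold (fun y => phi y * u y) x = phi x * fold u x.
Proof.
move=> phiP; rewrite -foldZ /fold /pos_fold.
by congr (fine _ - fine _); apply: eq_esum => i _; rewrite phiP.
Qed.

Lemma fold_seq u x (s : seq I) : uniq s ->
  (forall i, i \notin s -> u (tau i x) = 0) ->
  fold u x = \sum_(i <- s) u (tau i x).
Proof.
move=> us uN; rewrite /fold /pos_fold.
have H (v : T -> R) : (forall i, i \notin s -> v (tau i x) = 0) ->
    fine (\esum_(i in [set: I]) (Num.max (v (tau i x)) 0)%:E)%E =
    \sum_(i <- s) Num.max (v (tau i x)) 0.
  move=> vN; rewrite (esum_seq us) ?sumEFin // => i; first by rewrite lee_fin le_max lexx orbT.
  by move=> /vN ->; rewrite maxxx.
rewrite (H u) // (H (fun y => - u y)); last by move=> i /uN ->; rewrite oppr0.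
rewrite -sumrB; apply: eq_bigr => i _.
set a := u _; have [a0|a0] := leP 0 a.
  by rewrite max_r ?oppr_le0 // subr0.
by rewrite max_l ?oppr_ge0 1?ltW // sub0r opprK.
Qed.

(* rho acts on the quotient of T by tau, on which D carries the image of mu. *)
Variables rho rho' : T -> T.
Hypothesis mrho : measurable_fun setT rho.
Hypothesis mrho' : measurable_fun setT rho'.
Hypothesis rho_mu : forall A, measurable A -> mu (rho @^-1` A) = mu A.
Hypothesis rhoK : cancel rho rho'.
Hypothesis rho_tau : forall i x, rho' (tau i x) = tau i (rho' x).

(** As [rho'] commutes with the action, the preimage of [D] under [rho'] again meets every orbit at
    exactly one index. The left integral becomes one over this set, and folding brings it back to
    [D]. *)
Lemma integral_periodic (phi : T -> \bar R) : measurable_fun setT phi ->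
  (forall x, 0 <= phi x)%E -> (forall i x, phi (tau i x) = phi x) ->
  (\int[mu]_(x in D) phi (rho x) = \int[mu]_(x in D) phi x)%E.
Proof.
move=> mphi phi0 phiP.
pose psi y := (phi \_ (rho' @^-1` D)) y.
have mD' : measurable (rho' @^-1` D) by rewrite -[X in measurable X]setTI; exact: mrho'.
have psi0 y : (0 <= psi y)%E by apply: erestrict_ge0 => z _; exact: phi0.
have mpsi : measurable_fun setT psi.
  by apply/(measurable_restrictT _ mD'); exact: measurable_funS mphi.
transitivity (\int[mu]_x psi (rho x))%E.
  rewrite integral_mkcond; apply: eq_integral => x _.
  rewrite /psi !patchE; congr (if _ then _ else _).
  by apply/idP/idP; rewrite !inE /= rhoK.
have := @ge0_integral_preimage _ _ _ mu _ mrho rho_mu setT psi measurableT mpsi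
  (fun x _ => psi0 x).
rewrite preimage_setT => ->; rewrite integral_fold //.
apply: eq_integral => x _; have [i Di] := D_ex (rho' x).
rewrite (esum_point (i := i)) // /psi ?patchE.
  by rewrite mem_set /= ?rho_tau // phiP.
move=> j ji; rewrite patchE ifN // notin_setE /= rho_tau => Dj; apply: ji.
exact: D_uniq Dj Di.
Qed.

(** [rho] exchanges the positive and negative parts of [phi], so their integrals over [D] agree;
    being finite, they cancel. *)
Lemma Rintegral_antiperiodic (phi : T -> R) :
  mu.-integrable D (EFin \o phi) -> measurable_fun setT phi ->
  (forall i x, phi (tau i x) = phi x) -> (forall x, phi (rho x) = - phi x) ->
  \int[mu]_(x in D) phi x = 0.
Proof.
move=> iphi mphi phiP phiN; rewrite /Rintegral integralE.
rewrite (_ : (\int[mu]_(x in D) _^\- x = \int[mu]_(x in D) (EFin \o phi)^\+ x)%E).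
  by rewrite subee // integrable_pos_fin_num.
rewrite -(@integral_periodic (EFin \o phi)^\+%E) //.
- by apply: eq_integral => x _; rewrite funeposE funenegE /= phiN.
- by apply: measurable_funepos; exact/measurable_EFinP.
- by move=> i x; rewrite !funeposE /= phiP.
Qed.

End fold.

(** * Polynomials converging to a step function *)

Section step.
Context (R : realType).

Lemma bernoulli_le (a : R) N : -1 <= a -> 1 + N%:R * a <= (1 + a) ^+ N.
Proof.
move=> a1; elim: N => [|N IH]; first by rewrite mul0r addr0 expr0.
have a0 : 0 <= 1 + a by rewrite -lerBlDl sub0r.
rewrite exprS (le_trans _ (ler_wpM2l a0 IH)) // -subr_ge0.
have -> : (1 + a) * (1 + N%:R * a) - (1 + N.+1%:R * a) = N%:R * a ^+ 2.
  by rewrite -(natr1 N); ring.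
by apply: mulr_ge0 => //; exact: sqr_ge0.
Qed.

(** 1 - y^n is (1 - y) (1 + y + ... + y^(n-1)), and each of the n terms in the second factor is at
    least y^n. For fixed y < 1 this bounds n y^n uniformly in n. *)
Lemma mul_expr_le (y : R) n : 0 <= y <= 1 -> n%:R * y ^+ n * (1 - y) <= 1 - y ^+ n.
Proof.
move=> /andP[y0 y1]; elim: n => [|n IH]; first by rewrite !mul0r expr0 subrr.
have := ler_wpM2l y0 IH; have := exprn_ge0 n y0.
have : y ^+ n.+1 * (1 - y) <= 1 - y.
  by rewrite ler_piMl ?subr_ge0 // exprn_ile1.
by rewrite !exprS -natr1; nra.
Qed.

(* This sequence of polynomials in w turns an algebra of functions into a
   sigma-algebra of sets. *)
Lemma cvg_step (w : R) : 0 <= w <= 1 ->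
  (fun n => (1 - w ^+ (n + n)) ^+ (n * 4 ^ n)) @ \oo --> ((w < 2^-1)%R%:R : R).
Proof.
move=> /andP[w0 w1].
have a0 n : 0 <= w ^+ n by exact: exprn_ge0.
have a1 n : w ^+ n <= 1 by exact: exprn_ile1.
(* With N the outer exponent, N w^(2n) = n (2w)^(2n): it tends to 0 for w < 1/2 and is at least n
   for w >= 1/2. The factor n is what settles w = 1/2 itself. *)
have Na n : (n * 4 ^ n)%:R * w ^+ (n + n) = n%:R * (2 * w) ^+ n * (2 * w) ^+ n.
  by rewrite natrM natrX (_ : 4 = 2 * 2) ?exprMn ?exprD -?natrM //; ring.
have [w2|w2] := ltP w 2^-1.
  have y01 : 0 <= 2 * w < 1 by lra.
  have y01' : 0 <= 2 * w <= 1 by lra.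
  apply: (@squeeze_cvgr _ _ _ _ (fun n => 1 - (1 - 2 * w)^-1 * (2 * w) ^+ n) (cst 1)).
  - apply: nearW => n; apply/andP; split; last first.
      by rewrite exprn_ile1 ?subr_ge0 ?a1 // lerBlDr lerDl a0.
    have := @bernoulli_le (- w ^+ (n + n)) (n * 4 ^ n).
    rewrite lerN2 a1 => /(_ isT); apply: le_trans.
    rewrite mulrN Na lerD2l lerN2 ler_wpM2r ?exprn_ge0 ?mulr_ge0 //.
    rewrite -[leRHS]mul1r ler_pdivlMr ?subr_gt0; last by case/andP: y01.
    by rewrite (le_trans (mul_expr_le n y01')) // lerBlDr lerDl exprn_ge0 ?mulr_ge0.
  - rewrite -[X in _ --> X]subr0; apply: cvgB; first exact: cvg_cst.
    rewrite -(mulr0 (1 - 2 * w)^-1); apply: cvgM; first exact: cvg_cst.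
    by apply: cvg_expr; rewrite ger0_norm; lra.
  - exact: cvg_cst.
apply: (@squeeze_cvgr _ _ _ _ (cst 0) (fun n => n.+1%:R^-1)).
- near=> n.
  have n0 : (0 < n)%N by near: n; exists 1%N.
  apply/andP; split; first by rewrite exprn_ge0 // subr_ge0 a1.
  set a := w ^+ (n + n); set N := (n * 4 ^ n)%N.
  rewrite -[leRHS]mul1r ler_pdivlMr ?ltr0n //.
  (* Since (1 - a)^N (1 + a)^N <= 1, Bernoulli's lower bound on (1 + a)^N makes (1 - a)^N small. *)
  have n1Na : n.+1%:R <= (1 + a) ^+ N.
    have aN : -1 <= a by rewrite (le_trans _ (a0 _)) // lerN10.
    apply: le_trans (bernoulli_le N aN).
    rewrite -natr1 addrC lerD2l Na -mulrA ler_peMr // -exprMn exprn_ege1 //.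
    by nra.
  apply: (le_trans (ler_wpM2l _ n1Na)); first by rewrite exprn_ge0 // subr_ge0 a1.
  rewrite -exprMn exprn_ile1 //.
    by apply: mulr_ge0; [rewrite subr_ge0; exact: a1|rewrite addr_ge0 //; exact: a0].
  by have := a0 (n + n)%N; have := a1 (n + n)%N; rewrite -/a; nra.
- exact: cvg_cst.
- exact: cvg_harmonic.
Unshelve. all: by end_near. Qed.
End step.

(** * Density in L^2 of an algebra of bounded functions *)

Section dense_algebra.
Context d (T : measurableType d) (R : realType).
Variables (mu : {measure set T -> \bar R}) (D : set T).
Hypothesis mD : measurable D.
Hypothesis finD : (mu D < +oo)%E.
Variable P : set (T -> R).
Hypothesis P_meas : forall p, P p -> measurable_fun D p.
Hypothesis P_bnd : forall p, P p -> exists K : R, forall x, `|p x| <= K.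
Hypothesis P_cst : forall c, P (fun=> c).
Hypothesis PD : forall p q, P p -> P q -> P (fun x => p x + q x).
Hypothesis PM : forall p q, P p -> P q -> P (fun x => p x * q x).

Local Notation dist2 u v :=
  (\int[mu]_(x in D) ((u x - v x) ^+ 2)%:E)%E.

(** The closure of [P] in the squared L^2(D) distance, among measurable functions. *)
Definition approximable (u : T -> R) : Prop :=
  measurable_fun D u /\
  forall e : R, 0 < e -> exists2 p, P p & (dist2 u p <= e%:E)%E.

Let msq (u v : T -> R) : measurable_fun D u -> measurable_fun D v ->
  measurable_fun D (fun x => ((u x - v x) ^+ 2)%:E).
Proof.
move=> ? ?; apply/measurable_EFinP.
by apply: measurable_funX; exact: measurable_funB.
Qed.

Let int_comb (f g h : T -> R) (c : R) : 0 <= c ->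
  measurable_fun D f -> measurable_fun D g -> measurable_fun D h ->
  (forall x, 0 <= f x) -> (forall x, 0 <= g x) -> (forall x, 0 <= h x) ->
  (forall x, D x -> f x <= c * g x + c * h x) ->
  (\int[mu]_(x in D) (f x)%:E <=
    c%:E * \int[mu]_(x in D) (g x)%:E + c%:E * \int[mu]_(x in D) (h x)%:E)%E.
Proof.
move=> c0 mf mg mh f0 g0 h0 fgh.
have mcg (k : T -> R) : measurable_fun D k ->
    measurable_fun D (fun x => (c * k x)%:E).
  by move=> mk; apply/measurable_EFinP; exact: measurable_funM.
rewrite -!ge0_integralZl_EFin //; try by move=> x _; rewrite lee_fin.
all: try exact/measurable_EFinP.
rewrite -ge0_integralD //; try by move=> x _; rewrite -EFinM lee_fin mulr_ge0.
all: try (under eq_fun do rewrite -EFinM; exact: mcg).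
apply: ge0_le_integral => //.
- by move=> x _; rewrite lee_fin.
- exact/measurable_EFinP.
- by apply: emeasurable_funD; under eq_fun do rewrite -EFinM; exact: mcg.
Qed.

Let sqD (a b : R) : (a + b) ^+ 2 <= 2 * a ^+ 2 + 2 * b ^+ 2.
Proof. by rewrite -subr_ge0 (_ : _ - _ = (a - b) ^+ 2) ?sqr_ge0 //; ring. Qed.

Lemma approximable_P p : P p -> approximable p.
Proof.
move=> Pp; split; first exact: P_meas.
move=> e e0; exists p => //; under eq_integral do rewrite subrr expr0n.
by rewrite integral0 lee_fin ltW.
Qed.

Lemma approximable_lim (u : T -> R) : measurable_fun D u ->
  (forall e : R, 0 < e -> exists2 v, approximable v & (dist2 u v <= e%:E)%E) ->
  approximable u.
Proof.
move=> mu_ H; split => // e e0; have e4 : 0 < e / 4 by rewrite divr_gt0.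
have [v [mv Av] uv] := H _ e4; have [p Pp vp] := Av _ e4.
exists p => //; have mp := P_meas Pp.
apply: le_trans (@int_comb _ (fun x => (u x - v x) ^+ 2)
  (fun x => (v x - p x) ^+ 2) 2 _ _ _ _ _ _ _ _) _; rewrite ?sqr_ge0 //.
- by move/measurable_EFinP : (msq mu_ mp).
- by move/measurable_EFinP : (msq mu_ mv).
- by move/measurable_EFinP : (msq mv mp).
- by move=> x; rewrite sqr_ge0.
- by move=> x; rewrite sqr_ge0.
- by move=> x; rewrite sqr_ge0.
- move=> x _; rewrite (_ : u x - p x = (u x - v x) + (v x - p x)) ?sqD //; ring.
apply: (@le_trans _ _ (2%:E * (e / 4)%:E + 2%:E * (e / 4)%:E)%E).
  by rewrite leeD // lee_pmul2l.
by rewrite -!EFinM -EFinD lee_fin; lra.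
Qed.

Lemma approximableD u v : approximable u -> approximable v ->
  approximable (fun x => u x + v x).
Proof.
move=> [mu_ Au] [mv Av]; split; first exact: measurable_funD.
move=> e e0; have e4 : 0 < e / 4 by rewrite divr_gt0.
have [p Pp up] := Au _ e4; have [q Pq vq] := Av _ e4.
exists (fun x => p x + q x); first exact: PD.
have mp := P_meas Pp; have mq := P_meas Pq.
apply: le_trans (@int_comb _ (fun x => (u x - p x) ^+ 2)
  (fun x => (v x - q x) ^+ 2) 2 _ _ _ _ _ _ _ _) _; rewrite ?sqr_ge0 //.
- by move/measurable_EFinP : (msq (measurable_funD mu_ mv) (measurable_funD mp mq)).
- by move/measurable_EFinP : (msq mu_ mp).
- by move/measurable_EFinP : (msq mv mq).
- by move=> x; rewrite sqr_ge0.
- by move=> x; rewrite sqr_ge0.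
- by move=> x; rewrite sqr_ge0.
- move=> x _; rewrite (_ : _ - _ = (u x - p x) + (v x - q x)) ?sqD //; ring.
apply: (@le_trans _ _ (2%:E * (e / 4)%:E + 2%:E * (e / 4)%:E)%E).
  by rewrite leeD // lee_pmul2l.
by rewrite -!EFinM -EFinD lee_fin; lra.
Qed.

Let dist2M (u v w : T -> R) (K : R) : measurable_fun D u -> measurable_fun D v ->
  measurable_fun D w -> (forall x, D x -> `|w x| <= K) ->
  (dist2 (fun x => u x * w x) (fun x => v x * w x) <= (K ^+ 2)%:E * dist2 u v)%E.
Proof.
move=> mu_ mv mw wK; rewrite -ge0_integralZl_EFin ?sqr_ge0 //; first last.
- exact: msq.
- by move=> x _; rewrite lee_fin sqr_ge0.
apply: ge0_le_integral => //.
- by move=> x _; rewrite lee_fin sqr_ge0.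
- by apply: msq; exact: measurable_funM.
- by apply: emeasurable_funM => //; exact: msq.
move=> x Dx; rewrite -EFinM lee_fin -mulrBl exprMn mulrC.
rewrite ler_wpM2r ?sqr_ge0 // -(real_normK (num_real (w x))) lerXn2r ?nnegrE ?wK //.
exact: le_trans (wK _ Dx).
Qed.

Let small (K e : R) : 0 < e -> exists2 e', 0 < e' & K ^+ 2 * e' <= e.
Proof.
move=> e0; have K0 : 0 < K ^+ 2 + 1 by rewrite ltr_wpDl ?sqr_ge0.
(* The added 1 keeps the divisor positive when K = 0. *)
exists (e / (K ^+ 2 + 1)); first by rewrite divr_gt0.
by rewrite mulrA ler_pdivrMr // mulrC ler_wpM2l ?ltW // ltrDl.
Qed.

(** The factors are replaced one at a time: first u by some p in [P], at the cost of the bound of v;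
    then v by some q, at the cost of the bound of p, which is known only once p is chosen. *)
Lemma approximableM u v (K : R) : approximable u -> approximable v ->
  (forall x, D x -> `|v x| <= K) -> approximable (fun x => u x * v x).
Proof.
move=> [mu_ Au] [mv Av] vK; apply: approximable_lim; first exact: measurable_funM.
move=> e /(small K)[e1 e10 Ke1]; have [p Pp up] := Au _ e10.
have mp := P_meas Pp; have [L pL] := P_bnd Pp.
exists (fun x => p x * v x); last first.
  apply: (le_trans (dist2M mu_ mp mv vK)); apply: (@le_trans _ _ (K ^+ 2 * e1)%:E).
    by rewrite [leRHS]EFinM lee_wpmul2l // lee_fin sqr_ge0.
  by rewrite lee_fin.
apply: approximable_lim; first exact: measurable_funM.
move=> e' /(small L)[e2 e20 Le2]; have [q Pq vq] := Av _ e20.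
have mq := P_meas Pq.
exists (fun x => q x * p x); first by apply: approximable_P; exact: PM.
under eq_integral do rewrite (mulrC (p _)).
apply: (le_trans (dist2M mv mq mp (fun x _ => pL x))).
apply: (@le_trans _ _ (L ^+ 2 * e2)%:E); last by rewrite lee_fin.
by rewrite [leRHS]EFinM lee_wpmul2l // lee_fin sqr_ge0.
Qed.

(** Dominated convergence applied to the squared differences yields convergence in L^2(D), and the
    closure is closed. *)
Lemma approximable_dominated (u : T -> R) (u_ : (T -> R)^nat) (g : T -> R) :
  (forall n, approximable (u_ n)) -> measurable_fun D u ->
  (forall x, D x -> (u_ ^~ x) @ \oo --> u x) ->
  mu.-integrable D (EFin \o g) ->
  (forall n x, D x -> (u x - u_ n x) ^+ 2 <= g x) ->
  approximable u.
Proof.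
move=> Au mu_ uu ig ug; apply: approximable_lim => // e e0.
have mF n : measurable_fun D (fun x => ((u x - u_ n x) ^+ 2)%:E).
  by apply: msq => //; case: (Au n).
have cF x : D x -> (fun n => ((u x - u_ n x) ^+ 2)%:E) @ \oo --> 0%E.
  move=> Dx; apply: cvg_EFin; first by near=> n.
  rewrite [X in _ --> X](_ : _ = (u x - u x) ^+ 2); last by rewrite subrr expr0n.
  have cB : (fun n => u x - u_ n x) @ \oo --> u x - u x.
    by apply: cvgB; [exact: cvg_cst|exact: uu].
  by rewrite expr2; under eq_fun do rewrite expr2; exact: cvgM.
have Fg : {ae mu, forall x n, D x -> (`|((u x - u_ n x) ^+ 2)%:E| <= (EFin \o g) x)%E}.
  by apply: aeW => x n Dx; rewrite /= lee_fin ger0_norm ?sqr_ge0 // ug.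
have [_ _] := dominated_convergence mD mF (measurable_cst (0%E : \bar R)) (aeW _ cF) ig Fg.
rewrite integral0 => cv.
have /cv : nbhs (0%E : \bar R) [set y | (y < e%:E)%E].
  by apply: open_ereal_lt'; rewrite lte_fin.
move=> [N _ /(_ N (leqnn _)) /= lN].
by exists (u_ N) => //; exact: ltW.
Unshelve. all: by end_near. Qed.

Lemma approximable_ae (u v : T -> R) : approximable u -> measurable_fun D v ->
  {ae mu, forall x, D x -> u x = v x} -> approximable v.
Proof.
move=> [mu_ Au] mv uv; split => // e e0; have [p Pp up] := Au _ e0.
exists p => //; apply: le_trans up; have mp := P_meas Pp.
rewrite (@ge0_ae_eq_integral _ _ _ mu D
  (fun x => ((v x - p x) ^+ 2)%:E) (fun x => ((u x - p x) ^+ 2)%:E)) //.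
- exact: msq.
- exact: msq.
- by move=> x _; rewrite lee_fin sqr_ge0.
- by move=> x _; rewrite lee_fin sqr_ge0.
- by apply: filterS uv => x uv /uv ->.
Qed.

Lemma approximable_eq (u v : T -> R) : approximable u ->
  (forall x, D x -> u x = v x) -> approximable v.
Proof.
move=> Au uv; apply: (approximable_ae Au); last exact: aeW.
by case: Au => + _; apply: eq_measurable_fun => x; rewrite inE => /uv.
Qed.

Lemma approximable_cst c : approximable (fun=> c).
Proof. exact/approximable_P/P_cst. Qed.

Lemma approximableZ c u : approximable u -> approximable (fun x => c * u x).
Proof.
move=> Au; have := approximableM Au (approximable_cst c) (fun _ _ => lexx `|c|).
by move=> H; apply: (approximable_eq H) => x _; rewrite mulrC.
Qed.

Lemma approximable_sum (I : Type) (s : seq I) (u : I -> T -> R) :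
  (forall i, approximable (u i)) -> approximable (fun x => \sum_(i <- s) u i x).
Proof.
move=> Au; elim: s => [|i s IH].
  by apply: (approximable_eq (approximable_cst 0)) => x _; rewrite big_nil.
apply: (approximable_eq (approximableD (Au i) IH)) => x _.
by rewrite big_cons.
Qed.

Lemma approximable_bounded (u : T -> R) (u_ : (T -> R)^nat) :
  (forall n, approximable (u_ n)) -> (forall x, D x -> (u_ ^~ x) @ \oo --> u x) ->
  (forall n x, `|u_ n x| <= 1) -> (forall x, `|u x| <= 1) -> approximable u.
Proof.
(* 4 = (1 + 1)^2 dominates the squared difference of two functions bounded by 1, and is integrable
   because [D] has finite measure. *)
move=> Au uu b_ b; apply: (@approximable_dominated u u_ (cst 4)) => //.
- apply: (@measurable_fun_cvg _ _ _ D u_) => // n; by case: (Au n).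
- apply: measurable_bounded_integrable => //; exact: bounded_cst.
move=> n x _; rewrite -(real_normK (num_real (_ - _))).
have : `|u x - u_ n x| <= 2.
  by rewrite (le_trans (ler_normB _ _)) // (_ : 2 = 1 + 1) // lerD.
by move=> h; rewrite (_ : cst 4 x = 2 ^+ 2) ?lerXn2r ?nnegrE // /cst; ring.
Qed.

Definition approx_sets : set (set T) := [set A | approximable \1_A].

(** Complements come from 1 - 1_A and intersections from products of indicators; a countable union
    is the bounded pointwise limit of the finite ones. *)
Lemma sigma_algebra_approx_sets : sigma_algebra setT approx_sets.
Proof.
have ACc A : approx_sets A -> approx_sets (~` A).
  move=> AA; apply: (approximable_eq (approximableD (approximable_cst 1)
    (approximableZ (-1) AA))) => x _.
  by rewrite !indicE in_setC; case: (x \in A) => /=; rewrite ?mulr1 ?mulr0 ?subrr ?addr0.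
have AI A B : approx_sets A -> approx_sets B -> approx_sets (A `&` B).
  move=> AA AB.
  have B1 x : D x -> `|\1_B x : R| <= 1 by move=> _; rewrite indicE; case: (x \in B); rewrite ?normr1 ?normr0.
  by apply: (approximable_eq (approximableM AA AB B1)) => x _; rewrite indicI.
have A0 : approx_sets set0.
  by apply: (approximable_eq (approximable_cst 0)) => x _; rewrite indic0.
split => // [A AA|F AF]; first by rewrite setTD; exact: ACc.
have AU n : approx_sets (\bigcup_(k < n) F k).
  elim: n => [|n IH]; first by rewrite bigcup_mkord big_ord0.
  rewrite bigcup_mkord big_ord_recr /= -bigcup_mkord.
  by rewrite -[X in approx_sets X]setCK setCU; apply/ACc/AI; exact: ACc.
have n1 (A : set T) x : `|\1_A x : R| <= 1.
  by rewrite indicE; case: (x \in A); rewrite ?normr1 ?normr0.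
apply: (approximable_bounded AU) => // x Dx.
have [[n _ Fn]|nF] := pselect ((\bigcup_k F k) x).
  rewrite indicE mem_set; last by exists n.
  apply: cvg_near_cst; exists n.+1 => // m /= nm.
  by rewrite indicE mem_set //; exists n.
rewrite indicE memNset //; apply: cvg_near_cst; apply: nearW => m.
by rewrite indicE memNset // => -[k _ Fk]; apply: nF; exists k.
Qed.

Lemma P_exp (p : T -> R) n : P p -> P (fun x => p x ^+ n).
Proof.
move=> Pp; elim: n => [|n IH]; first by under eq_fun do rewrite expr0.
by under eq_fun do rewrite exprS; exact: PM.
Qed.

(** After an affine change of p the step occurs at 1/2, and the polynomials of [cvg_step] in the new
    function belong to the algebra [P]. *)
Lemma approx_sets_lt0 (p : T -> R) : P p -> approx_sets [set x | p x < 0].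
Proof.
move=> Pp; have [K pK] := P_bnd Pp.
(* Maps the range of p into [0, 1] with p < 0 exactly when w < 1/2; the absolute value and the added
   1 make the divisor positive whatever K is. *)
pose w x := 2^-1 + (2 * (`|K| + 1))^-1 * p x.
have K0 : 0 < `|K| + 1 by rewrite ltr_wpDl.
have Pw : P w by apply: PD; [exact: P_cst|apply: PM => //; exact: P_cst].
have w01 x : 0 <= w x <= 1.
  have : `|(2 * (`|K| + 1))^-1 * p x| <= 2^-1.
    rewrite normrM gtr0_norm ?invr_gt0 ?mulr_gt0 // invfM -mulrA.
    rewrite ler_piMr // ler_pdivrMl // mulr1 (le_trans (pK x)) //.
    by rewrite (le_trans (ler_norm _)) // lerDl.
  by rewrite ler_norml /w; lra.
have PN p' : P p' -> P (fun x => - p' x).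
  by move=> /(PM (P_cst (-1))); under eq_fun do rewrite mulN1r.
have B n x : 0 <= 1 - w x ^+ n <= 1.
  have /andP[w0 w1] := w01 x.
  by rewrite subr_ge0 exprn_ile1 //= lerBlDr lerDl exprn_ge0.
apply: (@approximable_bounded _ (fun n x => (1 - w x ^+ (n + n)) ^+ (n * 4 ^ n))).
- move=> n; apply: approximable_P; apply: P_exp; apply: PD => //.
  by apply: PN; exact: P_exp.
- move=> x _; rewrite indicE.
  rewrite (_ : (x \in _) = (w x < 2^-1)); first exact: cvg_step.
  rewrite /w gtrDl pmulr_rlt0 ?invr_gt0 ?mulr_gt0 //.
  by apply/idP/idP; rewrite inE.
- move=> n x; have /andP[b0 b1] := B (n + n)%N x.
  by rewrite ger0_norm ?exprn_ge0 // exprn_ile1.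
- by move=> x; rewrite indicE; case: (x \in _); rewrite ?normr1 ?normr0.
Qed.

Import HBNNSimple.

(** A nonnegative u is the increasing limit of simple functions, which are combinations of
    approximable indicators; the squared errors are dominated by u^2. The general case splits into
    positive and negative parts. *)
Lemma approximable_L2 (u : T -> R) : measurable `<=` approx_sets ->
  measurable_fun D u -> (\int[mu]_(x in D) ((u x) ^+ 2)%:E < +oo)%E ->
  approximable u.
Proof.
move=> mA.
have pos (v : T -> R) : measurable_fun D v -> (forall x, 0 <= v x) ->
    (\int[mu]_(x in D) ((v x) ^+ 2)%:E < +oo)%E -> approximable v.
  move=> mv v0 iv.
  have mEv : measurable_fun D (EFin \o v) by exact/measurable_EFinP.
  pose g := nnsfun_approx mD mEv.
  have gcv x : D x -> (fun n => g n x) @ \oo --> v x.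
    by move=> /(cvg_nnsfun_approx mD mEv (fun y _ => v0 y))/fine_cvg.
  have gv n x : D x -> g n x <= v x.
    move=> /gcv gx; rewrite -(cvg_lim (@Rhausdorff R) gx).
    apply: (nondecreasing_cvgn_le (u_ := fun n => g n x)); last by apply/cvg_ex; exists (v x).
    by move=> m k mk; have /lefP := nd_nnsfun_approx mD mEv mk.
  apply: (@approximable_dominated v (fun n => g n) (fun x => v x ^+ 2)) => //.
  - move=> n; pose h (x : T) : R :=
      \sum_(y <- finmap.enum_fset (fset_set (range (g n)))) y * \1_(g n @^-1` [set y]) x.
    have Ah : approximable h.
      by apply: approximable_sum => r; apply: approximableZ; exact: mA.
    refine (approximable_eq Ah _) => x _.
    by rewrite [RHS]fimfunE fsbig_finite.
  - apply/integrableP; split.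
      by apply/measurable_EFinP; exact: measurable_funX.
    by under eq_integral do rewrite /= ger0_norm ?sqr_ge0 //.
  move=> n x Dx; rewrite lerXn2r ?nnegrE ?subr_ge0 ?gv //.
  by rewrite lerBlDr lerDl.
move=> mu_ iu.
have sub (v : T -> R) : measurable_fun D v -> (forall x, v x ^+ 2 <= u x ^+ 2) ->
    (\int[mu]_(x in D) ((v x) ^+ 2)%:E < +oo)%E.
  move=> mv vu; apply: le_lt_trans iu; apply: ge0_le_integral => //.
  - by move=> x _; rewrite lee_fin sqr_ge0.
  - by apply/measurable_EFinP; exact: measurable_funX.
  - by apply/measurable_EFinP; exact: measurable_funX.
  - by move=> x _; rewrite lee_fin.
have mp (v : T -> R) : measurable_fun D v -> measurable_fun D (fun x => Num.max (v x) 0).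
  by move=> mv; apply: measurable_maxr => //; exact: measurable_cst.
have mN : measurable_fun D (fun x => - u x) by exact: measurableT_comp.
have Ap : approximable (fun x => Num.max (u x) 0).
  apply: pos; [exact: mp|by move=> x; rewrite le_max lexx orbT|].
  apply: sub => [|x]; first exact: mp.
  by have [|_] := leP 0 (u x); rewrite // expr0n sqr_ge0.
have An : approximable (fun x => Num.max (- u x) 0).
  apply: pos; [exact: mp|by move=> x; rewrite le_max lexx orbT|].
  apply: sub => [|x]; first exact: mp.
  by have [|_] := leP 0 (- u x); rewrite ?sqrrN // expr0n sqr_ge0.
apply: (approximable_eq (approximableD Ap (approximableZ (-1) An))) => x _.
have [a0|a0] := leP 0 (u x).
  by rewrite max_r ?oppr_le0 // mulr0 addr0.
by rewrite max_l ?oppr_ge0 1?ltW // mulN1r opprK add0r.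
Qed.
End dense_algebra.

(** * Real inner product, Bessel and Parseval for an orthogonal family *)

Section square_integrable.
Context d (T : measurableType d) (R : realType).
Variables (mu : {measure set T -> \bar R}) (D : set T).
Hypothesis mD : measurable D.

Definition square_integrable (f : T -> R) : Prop :=
  measurable_fun D f /\ mu.-integrable D (fun x => (f x ^+ 2)%:E).

Definition ip (f g : T -> R) : R := \int[mu]_(x in D) (f x * g x).

Lemma square_integrableP (f : T -> R) : measurable_fun D f ->
  (\int[mu]_(x in D) ((f x) ^+ 2)%:E < +oo)%E -> square_integrable f.
Proof.
move=> mf fi; split => //; apply/integrableP; split.
  by apply/measurable_EFinP; exact: measurable_funX.
by under eq_integral do rewrite abse_EFin ger0_norm ?sqr_ge0 //.
Qed.

Lemma square_integrable_bounded (f : T -> R) (K : R) : (mu D < +oo)%E -> measurable_fun D f ->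
  (forall x, `|f x| <= K) -> square_integrable f.
Proof.
move=> finD mf fK; apply: square_integrableP => //.
apply: (@le_lt_trans _ _ (\int[mu]_(x in D) (K ^+ 2)%:E)%E).
  apply: ge0_le_integral => //.
  - by move=> x _; rewrite lee_fin sqr_ge0.
  - by apply/measurable_EFinP; exact: measurable_funX.
  - move=> x _; rewrite lee_fin -(real_normK (num_real (f x))).
    by rewrite lerXn2r ?nnegrE ?fK // (le_trans _ (fK x)).
rewrite integral_cst // lte_mul_pinfty ?lee_fin ?sqr_ge0 //.
Qed.

Lemma integrable_mul f g : square_integrable f -> square_integrable g ->
  mu.-integrable D (fun x => (f x * g x)%:E).
Proof.
move=> [mf f2] [mg g2].
apply: (le_integrable mD _ _ (integrableD mD f2 g2)).
  by apply/measurable_EFinP; exact: measurable_funM.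
move=> x _; rewrite /= lee_fin [leRHS]ger0_norm ?addr_ge0 ?sqr_ge0 //.
rewrite ler_norml; apply/andP; split; rewrite -subr_ge0.
  rewrite (_ : _ - _ = ((f x + g x) ^+ 2 + f x ^+ 2 + g x ^+ 2) / 2); last by field.
  by rewrite divr_ge0 // !addr_ge0 ?sqr_ge0.
rewrite (_ : _ - _ = ((f x - g x) ^+ 2 + f x ^+ 2 + g x ^+ 2) / 2); last by field.
by rewrite divr_ge0 // !addr_ge0 ?sqr_ge0.
Qed.

Lemma square_integrableZ a f : square_integrable f ->
  square_integrable (fun x => a * f x).
Proof.
move=> [mf f2]; split; first exact: measurable_funM.
under eq_fun do rewrite exprMn EFinM.
exact: integrableZl.
Qed.

Lemma square_integrableD f g : square_integrable f -> square_integrable g ->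
  square_integrable (fun x => f x + g x).
Proof.
move=> sf sg; have [[mf f2] [mg g2]] := (sf, sg).
split; first exact: measurable_funD.
have i2 := integrableD mD (integrableZl mD 2 f2) (integrableZl mD 2 g2).
apply: (le_integrable mD _ _ i2).
  by apply/measurable_EFinP; apply: measurable_funX; exact: measurable_funD.
move=> x _; have h : 0 <= 2 * f x ^+ 2 + 2 * g x ^+ 2 by nra.
rewrite /= lee_fin (ger0_norm h) ger0_norm ?sqr_ge0 //.
by rewrite -subr_ge0 (_ : _ - _ = (f x - g x) ^+ 2) ?sqr_ge0 //; ring.
Qed.

Lemma square_integrable0 : square_integrable (fun=> 0).
Proof.
split; first exact: measurable_cst.
under eq_fun do rewrite expr0n; exact: integrable0.
Qed.

Lemma square_integrable_sum (I : Type) (s : seq I) (f : I -> T -> R) :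
  (forall i, square_integrable (f i)) ->
  square_integrable (fun x => \sum_(i <- s) f i x).
Proof.
move=> sf; elim: s => [|i s IH].
  by under eq_fun do rewrite big_nil; exact: square_integrable0.
by under eq_fun do rewrite big_cons; exact: square_integrableD.
Qed.

Lemma ipC f g : ip f g = ip g f.
Proof. by apply: eq_Rintegral => x _; rewrite mulrC. Qed.

Lemma ipD f g h : square_integrable f -> square_integrable g ->
  square_integrable h -> ip (fun x => f x + g x) h = ip f h + ip g h.
Proof.
move=> sf sg sh; rewrite /ip -RintegralD //; try exact: integrable_mul.
by apply: eq_Rintegral => x _; rewrite mulrDl.
Qed.

Lemma ipZ a f h : square_integrable f -> square_integrable h ->
  ip (fun x => a * f x) h = a * ip f h.
Proof.
move=> sf sh; rewrite /ip -RintegralZl //; last exact: integrable_mul.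
by apply: eq_Rintegral => x _; rewrite mulrA.
Qed.

Lemma ip_sum (I : Type) (s : seq I) (f : I -> T -> R) h :
  (forall i, square_integrable (f i)) -> square_integrable h ->
  ip (fun x => \sum_(i <- s) f i x) h = \sum_(i <- s) ip (f i) h.
Proof.
move=> sf sh; elim: s => [|i s IH].
  rewrite big_nil /ip; under eq_Rintegral do rewrite big_nil mul0r.
  by rewrite Rintegral_cst // mul0r.
rewrite big_cons -IH -ipD //; last exact: square_integrable_sum.
by apply: eq_Rintegral => x _; rewrite big_cons.
Qed.

Lemma ip_ge0 f : 0 <= ip f f.
Proof. by apply: Rintegral_ge0 => x _; rewrite -expr2 sqr_ge0. Qed.

Lemma ip_EFin f : square_integrable f ->
  (ip f f)%:E = (\int[mu]_(x in D) (f x ^+ 2)%:E)%E.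
Proof.
move=> [mf f2]; rewrite /ip /Rintegral.
under eq_integral do rewrite -expr2.
by rewrite fineK //; exact: integrable_fin_num.
Qed.

Variables (I : choiceType) (e : I -> T -> R) (c : R).
Hypothesis c0 : 0 < c.
Hypothesis se : forall i, square_integrable (e i).
Hypothesis orth : forall i j, ip (e i) (e j) = if i == j then c else 0.

Let comb (s : seq I) (al : I -> R) x := \sum_(i <- s) al i * e i x.

Let sc s al : square_integrable (comb s al).
Proof. by apply: square_integrable_sum => i; exact: square_integrableZ. Qed.

(** Completing the square in the coefficients: the optimal ones are [c^-1 * ip u (e i)], and the
    last sum measures the deviation from them. *)
Lemma ip_sub_comb u s (al : I -> R) : square_integrable u -> uniq s ->
  ip (fun x => u x - comb s al x) (fun x => u x - comb s al x) =
  ip u u - c^-1 * \sum_(i <- s) ip u (e i) ^+ 2 +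
    c * \sum_(i <- s) (al i - c^-1 * ip u (e i)) ^+ 2.
Proof.
move=> su us; set p := comb s al.
have sp : square_integrable p by exact: sc.
have E h : square_integrable h -> ip (fun x => u x - p x) h = ip u h - ip p h.
  move=> sh; rewrite -mulN1r -ipZ // -ipD //; last exact: square_integrableZ.
  by apply: eq_Rintegral => x _; rewrite mulN1r.
have sup : square_integrable (fun x => u x - p x).
  under eq_fun do rewrite -mulN1r.
  by apply: square_integrableD => //; exact: square_integrableZ.
have pE h : square_integrable h -> ip p h = \sum_(i <- s) al i * ip (e i) h.
  move=> sh; rewrite ip_sum // => [|i]; last exact: square_integrableZ.
  by apply: eq_bigr => i _; rewrite ipZ.
rewrite E // (ipC u) (ipC p) !E // (ipC u p) (pE u su) (pE p sp).
have -> : \sum_(i <- s) al i * ip (e i) p = \sum_(i <- s) c * al i ^+ 2.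
  rewrite !big_seq; apply: eq_bigr => i si; rewrite ipC pE //.
  rewrite (bigD1_seq i) //= orth eqxx big1_seq ?addr0; first by ring.
  by move=> j /andP[ji _]; rewrite orth (negPf ji) mulr0.
rewrite opprB addrA -addrA -[LHS]addrA -[RHS]addrA; congr (_ + _).
rewrite !mulr_sumr -!sumrN -!big_split /=; apply: eq_bigr => i _.
by rewrite (ipC (e i)); field; rewrite gt_eqF.
Qed.

Lemma bessel u s : square_integrable u -> uniq s ->
  \sum_(i <- s) ip u (e i) ^+ 2 <= c * ip u u.
Proof.
move=> su us; have := ip_ge0 (fun x => u x - comb s (fun i => c^-1 * ip u (e i)) x).
rewrite ip_sub_comb // [X in _ + c * X]big1 => [|i _]; last by rewrite subrr expr0n.
by rewrite mulr0 addr0 subr_ge0 ler_pdivrMl.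
Qed.

(** Bessel bounds every finite partial sum. Conversely, a combination approximating u is only
    improved by passing to the optimal coefficients, so the partial sum over its modes reaches the
    right-hand side up to eps. *)
Lemma parseval u : square_integrable u ->
  (forall eps : R, 0 < eps -> exists s : seq (R * I),
    (\int[mu]_(x in D) ((u x - \sum_(t <- s) t.1 * e t.2 x) ^+ 2)%:E <= eps%:E)%E) ->
  (\esum_(i in [set: I]) (ip u (e i) ^+ 2)%:E =
    c%:E * \int[mu]_(x in D) (u x ^+ 2)%:E)%E.
Proof.
move=> su dense; rewrite -ip_EFin // -EFinM; apply/eqP; rewrite eq_le; apply/andP; split.
  apply: ge_ereal_sup => _ [X [finX _] <-].
  by rewrite fsbig_finite //= sumEFin lee_fin bessel //; exact: finmap.fset_uniq.
apply/lee_addgt0Pr => eps eps0.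
have [|s sP] := dense (eps / c); first by rewrite divr_gt0.
(* The approximating list may repeat a mode; repetitions are merged and their coefficients added. *)
pose r := undup (map snd s).
pose al i := \sum_(t <- s | t.2 == i) t.1.
have cE x : \sum_(t <- s) t.1 * e t.2 x = comb r al x.
  rewrite /comb; under [RHS]eq_bigr do rewrite mulr_suml.
  rewrite (exchange_big_dep xpredT) //= big_seq [RHS]big_seq.
  apply: eq_bigr => t ts; rewrite (eq_bigl (fun i => i == t.2)); last first.
    by move=> i; rewrite eq_sym.
  have tr : t.2 \in r by rewrite mem_undup map_f.
  rewrite big_mkcond (bigD1_seq t.2) ?undup_uniq //= eqxx big1 ?addr0 // => i.
  by move=> /negPf ->.
have : ip (fun x => u x - comb r al x) (fun x => u x - comb r al x) <= eps / c.
  rewrite -lee_fin ip_EFin; first by under eq_integral do rewrite -cE.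
  under eq_fun do rewrite -mulN1r.
  by apply: square_integrableD => //; exact: square_integrableZ.
rewrite ip_sub_comb ?undup_uniq // => H.
apply: (@le_trans _ _ ((\sum_(i <- r) ip u (e i) ^+ 2) + eps)%:E).
  have H2 : 0 <= c * \sum_(i <- r) (al i - c^-1 * ip u (e i)) ^+ 2.
    by apply: mulr_ge0; [exact: ltW|apply: sumr_ge0 => i _; exact: sqr_ge0].
  have {}H : ip u u <= c^-1 * (\sum_(i <- r) ip u (e i) ^+ 2 + eps).
    by rewrite mulrDr (mulrC c^-1 eps); lra.
  by rewrite lee_fin -ler_pdivlMl.
rewrite EFinD leeD2r //; apply: esum_ge; exists [set` r].
  by split => //; exact: finite_seq.
by rewrite -fsbig_seq ?undup_uniq // sumEFin.
Qed.

End square_integrable.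

(** * Lattice coordinates and the fundamental domain *)

Section lattice_geometry.
Context (R : realType) (d : nat) (M : 'M[R]_d).
Hypothesis uM : M \in unitmx.
Local Notation X := (Rd R d).
Local Notation mu := (lebesgue R d).
Local Notation D := (fundamental_domain M : set X).

Lemma measurable_Rd d' (T' : measurableType d') (f : 'cV[R]_d -> T') :
  measurable_fun setT f -> measurable_fun setT (f : X -> T').
Proof.
move=> mf _ A mA; rewrite setTI; apply: borel_lebesgue_measurable.
by rewrite -[X in measurable X]setTI; exact: mf.
Qed.

Definition lcoord (i : 'I_d) (x : 'cV[R]_d) : R := (invmx M *m x) i ord0.

Definition lvec (z : 'cV[int]_d) : 'cV[R]_d := M *m map_mx intr z.

Definition lshift (z : 'cV[int]_d) (x : X) : X := (x : 'cV[R]_d) + lvec z.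

Lemma measurable_lcoord i : measurable_fun setT (lcoord i).
Proof.
rewrite (_ : lcoord i = fun x => \sum_j invmx M i j * cV_coord j x); last first.
  by apply/funext => x; rewrite /lcoord mxE.
apply: measurable_sum => j; apply: measurable_funM; first exact: measurable_cst.
exact: measurable_cV_coord.
Qed.

Lemma lcoordD i x y : lcoord i (x + y) = lcoord i x + lcoord i y.
Proof. by rewrite /lcoord mulmxDr mxE. Qed.

Lemma lcoord_mul i t : lcoord i (M *m t) = t i ord0.
Proof. by rewrite /lcoord mulKmx. Qed.

Lemma lcoord_lvec i z : lcoord i (lvec z) = (z i ord0)%:~R.
Proof. by rewrite lcoord_mul mxE. Qed.

Lemma lvecN z : lvec (- z) = - lvec z.
Proof. by rewrite /lvec map_mxN mulmxN. Qed.

Lemma lvec_inj : injective lvec.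
Proof.
move=> z w zw; apply/matrixP => i j; rewrite (ord1 j).
by apply: (@intr_inj R); rewrite -!lcoord_lvec zw.
Qed.

Lemma latticeE : lattice M = range lvec.
Proof. by []. Qed.

Lemma fundamental_domainP (x : 'cV[R]_d) :
  D x <-> forall i, 0 <= lcoord i x < 1.
Proof.
split=> [[t t01 <-] i|x01]; first by rewrite lcoord_mul; exact: t01.
by exists (invmx M *m x) => //; rewrite mulKVmx.
Qed.

Lemma measurable_fundamental_domain : measurable D.
Proof.
apply: borel_lebesgue_measurable.
rewrite (_ : fundamental_domain M =
    \big[setI/setT]_(i < d) (lcoord i @^-1` [set` `[0, 1[])).
  apply: bigsetI_measurable => i _; rewrite -[X in measurable X]setTI.
  by apply: measurable_lcoord => //; exact: measurable_itv.
apply/seteqP; split => x.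
  move=> /fundamental_domainP x01; rewrite -bigcap_seq => i /= _.
  by rewrite in_itv /=; exact: x01.
rewrite -bigcap_seq => h; apply/fundamental_domainP => i.
by have := h i; rewrite /= in_itv/=; apply; rewrite mem_index_enum.
Qed.

Lemma fundamental_domain_lty : (mu D < +oo)%E.
Proof.
(* The added 1 makes the bound strict, since [box] excludes its upper faces. *)
pose b i := \sum_j `|M i j| + 1.
have b0 i : 0 <= b i by rewrite addr_ge0 // sumr_ge0.
have bb i : - b i <= b i by rewrite (le_trans _ (b0 i)) // oppr_le0.
have mB : measurable (box (fun i => - b i) b : set X).
  by apply: borel_lebesgue_measurable; exact: measurable_box.
apply: (@le_lt_trans _ _ (mu (box (fun i => - b i) b))); last first.
  by rewrite lebesgue_box // ltry.
apply: le_measure; rewrite ?inE //; first exact: measurable_fundamental_domain.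
move=> _ [t t01 <-] i; rewrite mxE.
have : `|\sum_j M i j * t j ord0| <= \sum_j `|M i j|.
  rewrite (le_trans (ler_norm_sum _ _ _)) // ler_sum // => j _.
  have /andP[t0 t1] := t01 j.
  by rewrite normrM ler_piMr // ger0_norm // ltW.
by rewrite ler_norml /b; lra.
Qed.

Lemma measurable_lshift z : measurable_fun setT (lshift z).
Proof. exact: measurable_Rd_addr. Qed.

Lemma lebesgue_lshift z (A : set X) : measurable A ->
  mu (lshift z @^-1` A) = mu A.
Proof. by move=> _; exact: lebesgue_addr. Qed.

Lemma lshiftK z x : lshift (- z) (lshift z x) = x.
Proof. by rewrite /lshift lvecN addrK. Qed.

Lemma fundamental_domain_ex x : exists z, D (lshift z x).
Proof.
exists (\col_i - Num.floor (lcoord i x)).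
apply/fundamental_domainP => i; rewrite lcoordD lcoord_lvec mxE.
have := floor_itv (lcoord i x); rewrite intrD rmorphN /=.
by lra.
Qed.

Lemma fundamental_domain_uniq x z w :
  D (lshift z x) -> D (lshift w x) -> z = w.
Proof.
move=> /fundamental_domainP Dz /fundamental_domainP Dw.
apply/matrixP => i j; rewrite (ord1 j).
have := Dz i; have := Dw i; rewrite !lcoordD !lcoord_lvec.
set a := z i ord0; set b := w i ord0; set t := lcoord _ _ => h1 h2.
have ab : (a%:~R : R) < (b + 1)%:~R by rewrite intrD; lra.
have ba : (b%:~R : R) < (a + 1)%:~R by rewrite intrD; lra.
by move: ab ba; rewrite !ltr_int !ltzD1 => ab ba; apply/eqP; rewrite eq_le ab ba.
Qed.

End lattice_geometry.

(** * Sine and cosine of period 1 *)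

Section trigonometry.
Context (R : realType).
Implicit Types (a b t c : R) (z : int).

Definition cos1 t : R := cos (2 * pi * t).
Definition sin1 t : R := sin (2 * pi * t).

Lemma cos1D a b : cos1 (a + b) = cos1 a * cos1 b - sin1 a * sin1 b.
Proof. by rewrite /cos1 mulrDr cosD. Qed.

Lemma sin1D a b : sin1 (a + b) = sin1 a * cos1 b + cos1 a * sin1 b.
Proof. by rewrite /sin1 mulrDr sinD. Qed.

Lemma cos1N a : cos1 (- a) = cos1 a.
Proof. by rewrite /cos1 mulrN cosN. Qed.

Lemma sin1N a : sin1 (- a) = - sin1 a.
Proof. by rewrite /sin1 mulrN sinN. Qed.

Lemma cos1_0 : cos1 0 = 1.
Proof. by rewrite /cos1 mulr0 cos0. Qed.

Lemma sin1_0 : sin1 0 = 0.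
Proof. by rewrite /sin1 mulr0 sin0. Qed.

Lemma cos1_half : cos1 2^-1 = -1.
Proof. by rewrite /cos1 mulrAC divff ?mul1r ?cospi. Qed.

Lemma sin1_half : sin1 2^-1 = 0.
Proof. by rewrite /sin1 mulrAC divff ?mul1r ?sinpi. Qed.

Lemma cos1_int z : cos1 z%:~R = 1 /\ sin1 z%:~R = 0.
Proof.
have H n : cos1 n%:R = 1 /\ sin1 n%:R = 0.
  elim: n => [|n [c1 s0]]; first by rewrite cos1_0 sin1_0.
  rewrite -natr1 cos1D sin1D c1 s0 /cos1 /sin1 mulr1 mulr_natl cos2pi sin2pi.
  by split; ring.
case: z => n; first exact: H.
by rewrite NegzE rmorphN /= cos1N sin1N; have [-> ->] := H n.+1; rewrite oppr0.
Qed.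

Lemma cos1Dz t z : cos1 (t + z%:~R) = cos1 t.
Proof. by rewrite cos1D; have [-> ->] := cos1_int z; ring. Qed.

Lemma sin1Dz t z : sin1 (t + z%:~R) = sin1 t.
Proof. by rewrite sin1D; have [-> ->] := cos1_int z; ring. Qed.

Lemma cos1Dhalf t : cos1 (t + 2^-1) = - cos1 t.
Proof. by rewrite cos1D cos1_half sin1_half; ring. Qed.

Lemma sin1Dhalf t : sin1 (t + 2^-1) = - sin1 t.
Proof. by rewrite sin1D cos1_half sin1_half; ring. Qed.

Lemma cos1_le1 t : `|cos1 t| <= 1.
Proof. by rewrite ler_norml cos_geN1 cos_le1. Qed.

Lemma sin1_le1 t : `|sin1 t| <= 1.
Proof. by rewrite ler_norml sin_geN1 sin_le1. Qed.

Lemma sqr_cos1_sin1 t : cos1 t ^+ 2 + sin1 t ^+ 2 = 1.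
Proof. exact: cos2Dsin2. Qed.

Lemma sin1_gt0 t : 0 < t < 2^-1 -> 0 < sin1 t.
Proof.
move=> /andP[t0 t1]; apply: sin_gt0_pi.
rewrite !mulr_gt0 ?pi_gt0 //= mulrAC gtr_pMl ?pi_gt0 //; lra.
Qed.

Lemma sin1_ge0 t : 0 <= t <= 2^-1 -> 0 <= sin1 t.
Proof.
move=> /andP[]; rewrite le_eqVlt => /predU1P[<-|t0]; first by rewrite sin1_0.
rewrite le_eqVlt => /predU1P[->|t1]; first by rewrite sin1_half.
by rewrite ltW // sin1_gt0 ?t0.
Qed.

Lemma sin1_lt0 t : - 2^-1 < t < 0 -> sin1 t < 0.
Proof. by move=> h; rewrite -oppr_gt0 -sin1N sin1_gt0 //; lra. Qed.

Lemma sin1_lt0_half t : 2^-1 < t < 1 -> sin1 t < 0.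
Proof.
by move=> h; rewrite -(sin1Dz t (-1)) sin1_lt0 // rmorphN /= rmorph1; lra.
Qed.

(** On the circle R/Z each inequality describes an open half-circle. The arc from c to 1 is longer
    than a half-circle, hence a union of such; the sines become trigonometric polynomials in the
    lattice coordinate t. *)
Lemma lt_frac_lo t c : 0 <= t < 1 -> 0 <= c < 2^-1 ->
  (c < t) = [|| sin1 t < 0, sin1 (c - t) < 0 | sin1 (2^-1 * c + 2^-1 * 2^-1 - t) < 0].
Proof.
move=> t01 c01; apply/idP/or3P => [ct|].
  have [t2|t2] := ltP 2^-1 t; first by constructor 1; apply: sin1_lt0_half; lra.
  have [ct2|ct2] := ltP (- 2^-1) (c - t); first by constructor 2; apply: sin1_lt0; lra.
  (* Only c = 0, t = 1/2 is left, where the first two sines vanish. *)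
  by constructor 3; apply: sin1_lt0; lra.
have [//|tc] := ltP c t.
have s1 : 0 <= sin1 t by apply: sin1_ge0; lra.
have s2 : 0 <= sin1 (c - t) by apply: sin1_ge0; lra.
have s3 : 0 <= sin1 (2^-1 * c + 2^-1 * 2^-1 - t) by apply: sin1_ge0; lra.
by case; rewrite ltNge ?s1 ?s2 ?s3.
Qed.

(** Here the arc is at most a half-circle and is the intersection of two half-circles. *)
Lemma lt_frac_hi t c : 0 <= t < 1 -> 2^-1 <= c < 1 ->
  (c < t) = (sin1 t < 0) && (sin1 (c - t) < 0).
Proof.
move=> t01 c01; apply/idP/andP => [ct|[]].
  by split; [apply: sin1_lt0_half|apply: sin1_lt0]; lra.
have [//|tc] := ltP c t.
have [t2|t2] := ltP 2^-1 t => [_|].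
  by rewrite ltNge sin1_ge0 //; lra.
by rewrite ltNge sin1_ge0 //; lra.
Qed.

Lemma measurable_cos1 : measurable_fun setT cos1.
Proof.
apply: measurableT_comp; last by apply: measurable_funM.
by apply: continuous_measurable_fun; exact: continuous_cos.
Qed.

Lemma measurable_sin1 : measurable_fun setT sin1.
Proof.
apply: measurableT_comp; last by apply: measurable_funM.
by apply: continuous_measurable_fun; exact: continuous_sin.
Qed.

End trigonometry.

(** * The real trigonometric system on the fundamental domain *)

Section trigonometric_system.
Context (R : realType) (d : nat) (M : 'M[R]_d).
Hypothesis uM : M \in unitmx.
Local Notation X := (Rd R d).
Local Notation mu := (lebesgue R d).
Local Notation D := (fundamental_domain M : set X).
Local Notation I := 'cV[int]_d.
Local Notation mD := (measurable_fundamental_domain uM).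
Local Notation finD := (fundamental_domain_lty uM).

(** The inner product of x with the dual lattice vector having integer coordinates m in the dual
    basis. *)
Definition phase (m : I) (x : X) : R :=
  \sum_i (m i ord0)%:~R * lcoord M i x.

Lemma phaseD (m : I) (x y : 'cV[R]_d) : phase m (x + y) = phase m x + phase m y.
Proof.
by rewrite -big_split; apply: eq_bigr => i _; rewrite lcoordD mulrDr.
Qed.

Lemma phaseDl (m n : I) x : phase (m + n) x = phase m x + phase n x.
Proof.
by rewrite -big_split; apply: eq_bigr => i _; rewrite mxE rmorphD /= mulrDl.
Qed.

Lemma phaseN (m : I) x : phase (- m) x = - phase m x.
Proof.
by rewrite -sumrN; apply: eq_bigr => i _; rewrite mxE rmorphN /= mulNr.
Qed.

Lemma phase0 x : phase 0 x = 0.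
Proof. by rewrite /phase big1 // => i _; rewrite mxE mul0r. Qed.

Lemma phase_lshift m z x : exists k : int, phase m (lshift M z x) = phase m x + k%:~R.
Proof.
exists (\sum_i m i ord0 * z i ord0); rewrite /lshift phaseD; congr (_ + _).
rewrite rmorph_sum /=; apply: eq_bigr => i _.
by rewrite lcoord_lvec // rmorphM.
Qed.

Lemma phase_delta i x : phase (delta_mx i ord0) x = lcoord M i x.
Proof.
rewrite /phase (bigD1 i) //= mxE !eqxx mul1r big1 ?addr0 // => j ji.
by rewrite mxE (negPf ji) mul0r.
Qed.

Lemma measurable_phase m : measurable_fun setT (phase m).
Proof.
apply: measurable_sum => i; apply: measurable_funM; first exact: measurable_cst.
by apply: measurable_Rd; exact: measurable_lcoord.
Qed.

Definition cosp m (x : X) : R := cos1 (phase m x).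
Definition sinp m (x : X) : R := sin1 (phase m x).

(* This real orthogonal system replaces the complex exponentials; the pair of
   modes m and -m spans the same plane as the cosine and the sine. *)
Definition cas m (x : X) : R := cosp m x + sinp m x.

Lemma measurable_cosp m : measurable_fun setT (cosp m).
Proof. exact: measurableT_comp (@measurable_cos1 R) (measurable_phase m). Qed.

Lemma measurable_sinp m : measurable_fun setT (sinp m).
Proof. exact: measurableT_comp (@measurable_sin1 R) (measurable_phase m). Qed.

Lemma measurable_cas m : measurable_fun setT (cas m).
Proof.
by apply: measurable_funD; [exact: measurable_cosp|exact: measurable_sinp].
Qed.

Lemma cosp_lshift m z x : cosp m (lshift M z x) = cosp m x.
Proof. by rewrite /cosp; have [k ->] := phase_lshift m z x; rewrite cos1Dz. Qed.

Lemma sinp_lshift m z x : sinp m (lshift M z x) = sinp m x.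
Proof. by rewrite /sinp; have [k ->] := phase_lshift m z x; rewrite sin1Dz. Qed.

Lemma cas_le2 m x : `|cas m x| <= 2.
Proof.
rewrite (le_trans (ler_normD _ _)) // (_ : 2 = 1 + 1) //.
by rewrite lerD // ?cos1_le1 ?sin1_le1.
Qed.

(** Translation by half a period negates the modes of index m. As they are also periodic under the
    lattice, this forces their integral over D to vanish. *)
Lemma cosp_half m : m != 0 -> exists y : 'cV[R]_d, phase m y = 2^-1.
Proof.
move=> m0; have [i mi] : exists i, m i ord0 != 0.
  apply/existsP; apply: contraNT m0; rewrite negb_exists => /forallP m0.
  apply/eqP/matrixP => i j; rewrite (ord1 j) mxE; apply/eqP.
  by have := m0 i; rewrite negbK.
exists (M *m ((2 * (m i ord0)%:~R)^-1 *: delta_mx i ord0)).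
rewrite /phase (bigD1 i) //= lcoord_mul // !mxE !eqxx mulr1 big1 ?addr0; last first.
  by move=> j ji; rewrite lcoord_mul // !mxE (negPf ji) !mulr0.
by field; rewrite intr_eq0.
Qed.

Let integrableD_bounded (f : X -> R) (K : R) : measurable_fun setT f ->
  (forall x, `|f x| <= K) -> mu.-integrable D (EFin \o f).
Proof.
move=> mf fK; apply: measurable_bounded_integrable; first exact: mD.
- exact: finD.
- exact: measurable_funS mf.
exists K; split; first exact: num_real.
by move=> r Kr x _; rewrite /= (le_trans (fK x)) // ltW.
Qed.

Lemma Rintegral_antiphase (f : X -> R) (y : 'cV[R]_d) K :
  measurable_fun setT f -> (forall x, `|f x| <= K) ->
  (forall z x, f (lshift M z x) = f x) ->
  (forall x : X, f ((x : 'cV[R]_d) + y) = - f x) ->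
  \int[mu]_(x in D) f x = 0.
Proof.
move=> mf fK fP fN.
pose rho (x : X) : X := (x : 'cV[R]_d) + y.
pose rho' (x : X) : X := (x : 'cV[R]_d) - y.
apply: (@Rintegral_antiperiodic _ _ R _ mu (lshift M) -%R _ _ _ _ _ _ _ _ rho rho') => //.
- exact: measurable_lshift.
- exact: lebesgue_lshift.
- exact: opprK.
- exact: lshiftK.
- exact: mD.
- exact: fundamental_domain_ex.
- exact: fundamental_domain_uniq.
- exact: measurable_Rd_addr.
- exact: measurable_Rd_addr.
- by move=> A mA; exact: lebesgue_addr.
- by move=> x; rewrite /rho /rho' addrK.
- by move=> z x; rewrite /rho' /lshift addrAC.
- exact: (integrableD_bounded mf fK).
Qed.

Lemma Rintegral_cosp m : m != 0 -> \int[mu]_(x in D) cosp m x = 0.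
Proof.
move=> /cosp_half[y my]; apply: (@Rintegral_antiphase _ y 1).
- exact: measurable_cosp.
- by move=> x; exact: cos1_le1.
- exact: cosp_lshift.
- by move=> x; rewrite /cosp phaseD my cos1Dhalf.
Qed.

Lemma Rintegral_sinp m : \int[mu]_(x in D) sinp m x = 0.
Proof.
have [->|/cosp_half[y my]] := eqVneq m 0.
  under eq_Rintegral do rewrite /sinp phase0 sin1_0.
  by rewrite Rintegral_cst ?mul0r //; exact: mD.
apply: (@Rintegral_antiphase _ y 1).
- exact: measurable_sinp.
- by move=> x; exact: sin1_le1.
- exact: sinp_lshift.
- by move=> x; rewrite /sinp phaseD my sin1Dhalf.
Qed.

(** Source of both key properties of [cas]: orthogonality, because the sine term always has mean
    zero and the cosine term has mean zero unless m = n; and closure of the span under products. *)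
Lemma casM m n x : cas m x * cas n x = cosp (m - n) x + sinp (m + n) x.
Proof.
rewrite /cas /cosp /sinp !phaseDl phaseN cos1D sin1D cos1N sin1N; ring.
Qed.

Lemma ip_cas m n :
  ip mu D (cas m) (cas n) = if m == n then fine (mu D) else 0.
Proof.
rewrite /ip; under eq_Rintegral do rewrite casM.
rewrite RintegralD; first last.
- by apply: (integrableD_bounded (measurable_sinp _)) => x; exact: sin1_le1.
- by apply: (integrableD_bounded (measurable_cosp _)) => x; exact: cos1_le1.
- exact: mD.
rewrite Rintegral_sinp addr0; case: eqVneq => [->|mn]; last first.
  by rewrite Rintegral_cosp // subr_eq0.
under eq_Rintegral do rewrite subrr /cosp phase0 cos1_0.
by rewrite Rintegral_cst ?mul1r //; exact: mD.
Qed.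

Lemma square_integrable_cas m : square_integrable mu D (cas m).
Proof.
apply: (square_integrable_bounded mD finD) (cas_le2 m).
exact: measurable_funS (measurable_cas m).
Qed.

(** Coefficients are kept in a list where a mode may recur, so that a sum is a mere
    concatenation. *)
Definition trig_poly : set (X -> R) :=
  [set p | exists s : seq (R * I), p = fun x => \sum_(t <- s) t.1 * cas t.2 x].

Lemma trig_polyD p q : trig_poly p -> trig_poly q ->
  trig_poly (fun x => p x + q x).
Proof.
move=> [s ->] [r ->]; exists (s ++ r).
by apply/funext => x; rewrite big_cat.
Qed.

Lemma trig_polyZ c p : trig_poly p -> trig_poly (fun x => c * p x).
Proof.
move=> [s ->]; exists [seq (c * t.1, t.2) | t <- s]; apply/funext => x.
by rewrite big_map mulr_sumr; apply: eq_bigr => t _; rewrite mulrA.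
Qed.

Lemma trig_poly_cas m : trig_poly (cas m).
Proof.
by exists [:: (1, m)]; apply/funext => x; rewrite big_seq1 mul1r.
Qed.

Lemma trig_poly0 : trig_poly (fun=> 0).
Proof. by exists [::]; apply/funext => x; rewrite big_nil. Qed.

Lemma trig_poly_sum (J : Type) (s : seq J) (p : J -> X -> R) :
  (forall j, trig_poly (p j)) -> trig_poly (fun x => \sum_(j <- s) p j x).
Proof.
move=> Pp; elim: s => [|j s IH].
  by under eq_fun do rewrite big_nil; exact: trig_poly0.
by under eq_fun do rewrite big_cons; exact: trig_polyD.
Qed.

Lemma trig_poly_cosp m : trig_poly (cosp m).
Proof.
rewrite (_ : cosp m = fun x => 2^-1 * (cas m x + cas (- m) x)).
  by apply/trig_polyZ/trig_polyD; exact: trig_poly_cas.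
apply/funext => x; rewrite /cas /cosp /sinp phaseN cos1N sin1N.
by field.
Qed.

Lemma trig_poly_sinp m : trig_poly (sinp m).
Proof.
rewrite (_ : sinp m = fun x => 2^-1 * (cas m x + -1 * cas (- m) x)).
  by apply/trig_polyZ/trig_polyD; [|apply: trig_polyZ]; exact: trig_poly_cas.
apply/funext => x; rewrite /cas /cosp /sinp phaseN cos1N sin1N.
by field.
Qed.

Lemma trig_polyM p q : trig_poly p -> trig_poly q ->
  trig_poly (fun x => p x * q x).
Proof.
move=> [s ->] [r ->].
under eq_fun do rewrite big_distrlr /=.
apply: trig_poly_sum => t; apply: trig_poly_sum => u.
under eq_fun do rewrite mulrACA casM.
apply: trig_polyZ; apply: trig_polyD; [exact: trig_poly_cosp|exact: trig_poly_sinp].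
Qed.

Lemma trig_poly_cst c : trig_poly (fun=> c).
Proof.
rewrite (_ : (fun=> c) = fun x => c * cosp 0 x).
  by apply: trig_polyZ; exact: trig_poly_cosp.
by apply/funext => x; rewrite /cosp phase0 cos1_0 mulr1.
Qed.

Lemma measurable_trig_poly p : trig_poly p -> measurable_fun D p.
Proof.
move=> [s ->]; apply: measurable_funS (measurableT) _ _ => //.
by apply: measurable_sum => t; apply: measurable_funM => //; exact: measurable_cas.
Qed.

Lemma bounded_trig_poly p : trig_poly p -> exists K : R, forall x, `|p x| <= K.
Proof.
move=> [s ->]; exists (\sum_(t <- s) `|t.1| * 2) => x.
rewrite (le_trans (ler_norm_sum _ _ _)) // ler_sum // => t _.
by rewrite normrM ler_wpM2l // cas_le2.
Qed.

End trigonometric_system.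

(** * Completeness of the trigonometric system and Parseval on the fundamental domain *)

Section trigonometric_density.
Context (R : realType) (d : nat) (M : 'M[R]_d).
Hypothesis uM : M \in unitmx.
Local Notation X := (Rd R d).
Local Notation mu := (lebesgue R d).
Local Notation D := (fundamental_domain M : set X).
Local Notation I := 'cV[int]_d.
Local Notation mD := (measurable_fundamental_domain uM).
Local Notation finD := (fundamental_domain_lty uM).
Local Notation mP := (@measurable_trig_poly R d M).
Local Notation bP := (@bounded_trig_poly R d M).
Local Notation cP := (@trig_poly_cst R d M).
Local Notation addP := (@trig_polyD R d M).
Local Notation mulP := (@trig_polyM R d M).
Local Notation approx := (approximable mu D (trig_poly M)).
Local Notation approx_set := (approx_sets mu D (trig_poly M)).

Let approxS : sigma_algebra setT approx_set.
Proof. exact: (sigma_algebra_approx_sets mD finD mP bP cP addP mulP). Qed.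

Let approx_setE (A B : set X) : (forall x, D x -> A x <-> B x) ->
  approx_set A -> approx_set B.
Proof.
move=> AB AA; apply: (approximable_eq mD mP AA) => x /AB [AxBx BxAx].
by rewrite !indicE; congr (nat_of_bool _)%:R; apply/idP/idP; rewrite !inE.
Qed.

Let approx_setC A : approx_set A -> approx_set (~` A).
Proof. by case: approxS => _ + _ => /[apply]; rewrite setTD. Qed.

Let approx_setU A B : approx_set A -> approx_set B -> approx_set (A `|` B).
Proof.
by move=> a b; rewrite -bigcup2E; case: approxS => ? _; apply => -[|[|n]].
Qed.

Let approx_setT : approx_set setT.
Proof. by rewrite -setC0; apply: approx_setC; case: approxS. Qed.

Let approx_setI A B : approx_set A -> approx_set B -> approx_set (A `&` B).
Proof.
move=> a b; rewrite -[X in approx_set X]setCK setCI.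
by apply: approx_setC; apply: approx_setU; exact: approx_setC.
Qed.

Let approx_sin i (c : R) : approx_set [set x | sin1 (c - lcoord M i x) < 0].
Proof.
rewrite (_ : [set x | _] = [set x : X | sin1 c * cosp M (delta_mx i ord0) x +
    (- cos1 c) * sinp M (delta_mx i ord0) x < 0]).
  apply: (approx_sets_lt0 mD finD mP bP cP addP mulP).
  apply: trig_polyD; apply: trig_polyZ; first exact: trig_poly_cosp.
  exact: trig_poly_sinp.
apply/funext => x; rewrite /= sin1D cos1N sin1N /cosp /sinp phase_delta.
by rewrite mulrN mulNr.
Qed.

(** On D the coordinate lies in [0, 1), so only 0 <= c < 1 matters; there the half-space is a union
    or an intersection of sets where a sine, a trigonometric polynomial of one mode, is negative. *)
Let approx_lcoord i (c : R) : approx_set [set x | c < lcoord M i x].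
Proof.
have half : approx_set [set x | sin1 (lcoord M i x) < 0].
  have := approx_sin i 2^-1; congr approx_set; apply/funext => x /=.
  by rewrite addrC sin1Dhalf sin1N opprK.
have D01 (x : X) : D x -> 0 <= lcoord M i x < 1.
  by move=> /(fundamental_domainP uM); exact.
have [c0|c0] := ltP c 0.
  apply: approx_setE approx_setT => x /D01/andP[x0 _]; split => // _.
  exact: lt_le_trans c0 x0.
have [c1|c1] := leP 1 c.
  apply: approx_setE (approx_setC approx_setT) => x /D01/andP[_ x1].
  by rewrite setCT /= ltNge (le_trans (ltW x1) c1).
have [c2|c2] := ltP c 2^-1.
  have c02 : 0 <= c < 2^-1 by rewrite c0.
  apply: approx_setE (approx_setU half (approx_setU (approx_sin i c)
    (approx_sin i (2^-1 * c + 2^-1 * 2^-1)))) => x /D01 x01.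
  rewrite /= (lt_frac_lo x01 c02); split.
    by case=> [->|[->|->]]; rewrite ?orbT.
  by case/or3P => ->; [left|right; left|right; right].
have c21 : 2^-1 <= c < 1 by rewrite c2.
apply: approx_setE (approx_setI half (approx_sin i c)) => x /D01 x01.
by rewrite /= (lt_frac_hi x01 c21); split => [[-> ->]|/andP[]].
Qed.

(** The same points with the approximable sets as measurable sets: that every Borel set is
    approximable becomes measurability of the identity from [Y] to R^d, which is checked on
    coordinates. *)
Local Notation Y := (g_sigma_algebraType approx_set).

Let measurableYE : @measurable _ Y = approx_set.
Proof. exact: sigma_algebra_id. Qed.

Let measurable_lcoordY i : measurable_fun (setT : set Y) (lcoord M i : Y -> R).
Proof.
apply: (measurability _ (RGenOInfty.measurableE R)) => _ [_ [c ->] <-].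
rewrite setTI measurableYE; have := approx_lcoord i c.
by congr approx_set; apply/funext => x /=; rewrite in_itv /= andbT.
Qed.

Let approx_borel (A : set 'cV[R]_d) : measurable A -> approx_set A.
Proof.
move=> mA; rewrite -measurableYE.
have : measurable_fun (setT : set Y) (id : Y -> 'cV[R]_d).
  apply: measurable_fun_cVP => i.
  rewrite (_ : _ \o _ = fun x : Y => \sum_j M i j * lcoord M j x).
    by apply: measurable_sum => j; apply: measurable_funM.
  apply/funext => x; rewrite /= /cV_coord -[in LHS](mulKVmx uM x) mxE.
  by [].
by move=> /(_ measurableT A mA); rewrite setTI.
Qed.

(** The outer measure gives a Borel set B containing A [&] D whose measure exceeds that of A [&] D
    by at most e. On D the squared difference of the indicators of A and B is the indicator of the
    excess. *)
Let approx_lebesgue (A : set X) : measurable A -> approx_set A.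
Proof.
move=> mA; have mDA : measurable (A `&` D) by apply: measurableI => //; exact: mD.
have finDA : (mu (A `&` D) < +oo)%E.
  by apply: (le_lt_trans _ finD); apply: le_measure; rewrite ?inE //; exact: mD.
apply: (approximable_lim mD mP) => [|e e0].
  exact: measurable_indic.
have /lb_ereal_inf_adherent : mu (A `&` D) \is a fin_num by rewrite ge0_fin_numE.
move=> /(_ e e0)[_ [F [mF AF] <-] Fe].
pose B : set X := \bigcup_n F n.
have mBo : measurable (\bigcup_n F n : set 'cV[R]_d) by exact: bigcupT_measurable.
have mB : measurable B by exact: borel_lebesgue_measurable.
have muB : (mu B <= mu (A `&` D) + e%:E)%E.
  rewrite lebesgue_borel //; apply: le_trans (ltW Fe).
  exact: measure_sigma_subadditive.
exists \1_B; first exact: approx_borel.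
rewrite (eq_integral (fun x => (\1_(B `\` (A `&` D)) x)%:E)) => [|x xD].
  rewrite integral_indic; [|exact: mD|exact: measurableD].
  apply: (@le_trans _ _ (mu (B `\` (A `&` D)))).
    apply: le_measure; rewrite ?inE //; first apply: measurableI; try exact: measurableD.
    exact: mD.
  have -> : mu (B `\` (A `&` D)) = (mu B - mu (A `&` D))%E.
    rewrite measureD // ?(setIidr AF) //.
    exact: le_lt_trans muB (lte_add_pinfty finDA (ltry _)).
  by rewrite leeBlDl // ge0_fin_numE.
rewrite !indicE in_setD in_setI xD andbT; congr (_%:E).
have [xA|xA] := boolP (x \in A); case: (boolP (x \in B)) => xB /=;
  rewrite ?subrr ?subr0 ?sub0r ?sqrrN ?expr0n ?expr1n //.
exfalso; move: xB; rewrite notin_setE; apply; apply: AF.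
by split; apply/set_mem.
Qed.

Lemma approximable_square_integrable (u : X -> R) :
  square_integrable mu D u -> approx u.
Proof.
move=> [mu_ iu]; apply: (approximable_L2 mD mP bP cP addP mulP) => //.
have /integrableP[_] := iu; apply: le_lt_trans.
by under [in leRHS]eq_integral do rewrite abse_EFin ger0_norm ?sqr_ge0 //.
Qed.

Hypothesis D0 : 0 < fine (mu D).

Lemma parseval_cas (u : X -> R) : square_integrable mu D u ->
  (\esum_(m in [set: I]) (ip mu D u (cas M m) ^+ 2)%:E =
    (fine (mu D))%:E * \int[mu]_(x in D) (u x ^+ 2)%:E)%E.
Proof.
move=> su; apply: (parseval mD D0 (@square_integrable_cas _ _ _ uM) (ip_cas uM) su).
move=> eps eps0; have [_ /(_ _ eps0)] := approximable_square_integrable su.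
by move=> [p [s ->] ?]; exists s.
Qed.

End trigonometric_density.

(** * A Vandermonde estimate for separated points *)

Section vandermonde.
Context (R : realType).
Import Normc.
Implicit Types (I : eqType).

(* The coefficient of a point is isolated by applying, for every other point
   z', the difference operator G |-> (j |-> G (j + 1) - z' * G j). *)
Lemma vandermonde_coef I (s : seq I) (z f : I -> R[i]) (delta B : R) :
  0 < delta -> uniq s -> (forall i, normc (z i) <= 1) ->
  {in s &, forall i j, i != j -> delta <= normc (z i - z j)} ->
  (forall j, (j < size s)%N -> normc (\sum_(i <- s) f i * z i ^+ j) <= B) ->
  {in s, forall i, normc (f i) <= (2 / delta) ^+ (size s).-1 * B}.
Proof.
move=> d0; move En : (size s) => n; elim: n s f B En => [|n IH] s f B En us z1 sep GB i si.
  by move: si; rewrite (size0nil En).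
have [/hasP[b bs bi]|/hasPn h] := boolP (has (fun b => b != i) s); last first.
  have s1 : s = [:: i].
    have ss : {subset s <= [:: i]}.
      by move=> b /h; rewrite negbK mem_seq1.
    have := uniq_leq_size us ss; rewrite /= En ltnS leqn0 => /eqP n0.
    move: En si; rewrite n0; case: (s) => [//|a [|//]] _.
    by rewrite mem_seq1 => /eqP ->.
  move: En; rewrite s1 => -[<-]; rewrite expr0 mul1r.
  by have := GB 0%N isT; rewrite s1 big_seq1 expr0 mulr1.
have ur : uniq (rem b s) by exact: rem_uniq.
have sr : size (rem b s) = n by rewrite size_rem // En.
have subr : {subset rem b s <= s} by exact: mem_rem.
have ir : i \in rem b s by rewrite mem_rem_uniq // !inE eq_sym bi si.
pose f' c := f c * (z c - z b).
(* Each removed point costs a factor 2 here, because |z b| <= 1, and a factor 1 / delta when f' is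
   converted back to f. *)
have G' j : (j < n)%N -> normc (\sum_(c <- rem b s) f' c * z c ^+ j) <= 2 * B.
  move=> jn.
  have -> : \sum_(c <- rem b s) f' c * z c ^+ j =
      \sum_(c <- s) f c * z c ^+ j.+1 - z b * \sum_(c <- s) f c * z c ^+ j.
    rewrite mulr_sumr -sumrB [RHS](big_rem b) //= exprS.
    rewrite [X in X + _](_ : _ = 0) ?add0r; last by ring.
    by apply: eq_bigr => c _; rewrite /f' exprS; ring.
  rewrite (le_trans (le_normcD _ _)) // normcN normcM.
  have GBj : normc (\sum_(c <- s) f c * z c ^+ j) <= B.
    by apply: GB; rewrite ltnS ltnW.
  have GBj1 : normc (\sum_(c <- s) f c * z c ^+ j.+1) <= B by exact: GB.
  have n0 (x : R[i]) : 0 <= normc x by case: x => a c; rewrite /= sqrtr_ge0.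
  have := z1 b; have := n0 (z b); have := n0 (\sum_(c <- s) f c * z c ^+ j); nra.
have n0 : (0 < n)%N by rewrite -sr; case: (rem b s) ir.
have sep' : {in rem b s &, forall i j, i != j -> delta <= normc (z i - z j)}.
  by move=> c c' /subr cs /subr c's; exact: sep.
have := IH _ _ _ sr ur z1 sep' G' i ir.
rewrite normcM => H; have sib := sep _ _ si bs.
rewrite eq_sym in bi; have {}sib := sib bi.
have nf : 0 <= normc (f i) by case: (f i) => a c; rewrite /= sqrtr_ge0.
have : normc (f i) * delta <= (2 / delta) ^+ n.-1 * (2 * B).
  by rewrite (le_trans _ H) // ler_wpM2l.
rewrite -ler_pdivlMr //= mulrA.
by rewrite -[in (2 / delta) ^+ n](prednK n0) exprSr mulrA mulrAC (mulrAC _ _ B).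
Qed.

(** Each term is at most the square root of the sum of squares. Any constant depending only on the
    number of terms serves the purpose. *)
Lemma sqr_sum_le I (s : seq I) (a : I -> R) : (forall i, 0 <= a i) ->
  (\sum_(i <- s) a i) ^+ 2 <= (size s)%:R ^+ 2 * \sum_(i <- s) a i ^+ 2.
Proof.
move=> a0; set A := \sum_(i <- s) a i ^+ 2.
have A0 : 0 <= A by apply: sumr_ge0 => i _; exact: sqr_ge0.
have aA : {in s, forall i, a i <= Num.sqrt A}.
  move=> i si; rewrite -(ger0_norm (a0 i)) -sqrtr_sqr ler_sqrt //.
  by rewrite /A (big_rem i) //= lerDl sumr_ge0 // => j _; exact: sqr_ge0.
rewrite -[A in leRHS]sqr_sqrtr // -exprMn lerXn2r ?nnegrE ?sumr_ge0 //.
rewrite big_seq; apply: (@le_trans _ _ (\sum_(i <- s | i \in s) Num.sqrt A)).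
  by apply: ler_sum => i; exact: aA.
by rewrite -big_seq big_const_seq count_predT iter_addr_0 mulr_natl.
Qed.

Lemma normc_ge0 (x : R[i]) : 0 <= normc x.
Proof. by case: x => a b; rewrite /= sqrtr_ge0. Qed.

Lemma normc_sum I (s : seq I) (F : I -> R[i]) :
  normc (\sum_(i <- s) F i) <= \sum_(i <- s) normc (F i).
Proof.
elim: s => [|i s IH]; first by rewrite !big_nil normc0.
by rewrite !big_cons (le_trans (le_normcD _ _)) // lerD2l.
Qed.

Lemma normcX (x : R[i]) n : normc (x ^+ n) = normc x ^+ n.
Proof.
elim: n => [|n IH]; first by rewrite !expr0 normc1.
by rewrite !exprS normcM IH.
Qed.

Lemma vandermonde_frame (k : nat) (delta : R) : 0 < delta <= 1 ->
  exists A B : R, [/\ 0 < A, 0 < B &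
  forall I (s : seq I) (z f : I -> R[i]), uniq s -> (size s <= k)%N ->
    (forall i, normc (z i) = 1) ->
    {in s &, forall i j, i != j -> delta <= normc (z i - z j)} ->
    A * \sum_(i <- s) normc (f i) ^+ 2 <=
      \sum_(j < k) normc (\sum_(i <- s) f i * z i ^+ j) ^+ 2 <=
    B * \sum_(i <- s) normc (f i) ^+ 2].
Proof.
(* As delta <= 1, the base 2 / delta is at least 1, so one exponent k covers all fibre sizes up to
   k. *)
move=> /andP[d0 d1]; pose C := (2 / delta) ^+ k.
have C0 : 0 < C by rewrite exprn_gt0 // divr_gt0.
have k0 : 0 < k%:R + 1 :> R by rewrite ltr_wpDl.
have kC0 : 0 < (k%:R + 1) * C ^+ 2 by apply: mulr_gt0 => //; exact: exprn_gt0.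
(* k + 1 stays positive for k = 0. In the upper constant two factors bound the square of a sum over
   the fibre, and the third counts the exponents j. *)
exists (((k%:R + 1) * C ^+ 2)^-1), ((k%:R + 1) ^+ 3); split.
- by rewrite invr_gt0.
- by rewrite exprn_gt0.
move=> I s z f us sk z1 sep; set E := \sum_(j < k) _; set F := \sum_(i <- s) _.
have E0 : 0 <= E by apply: sumr_ge0 => j _; exact: sqr_ge0.
have F0 : 0 <= F by apply: sumr_ge0 => j _; exact: sqr_ge0.
have z1' i : normc (z i) <= 1 by rewrite z1.
have sk' : (size s)%:R <= k%:R + 1 :> R by rewrite ler_wpDr // ler_nat.
apply/andP; split.
  rewrite ler_pdivrMl //.
  have G j : (j < size s)%N -> normc (\sum_(i <- s) f i * z i ^+ j) <= Num.sqrt E.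
    move=> /leq_trans/(_ sk) jk.
    rewrite -(ger0_norm (normc_ge0 _)) -sqrtr_sqr ler_sqrt //.
    rewrite /E (bigD1 (Ordinal jk)) //= lerDl sumr_ge0 // => i _; exact: sqr_ge0.
  have H := vandermonde_coef d0 us z1' sep G.
  have fC : {in s, forall i, normc (f i) ^+ 2 <= C ^+ 2 * E}.
    move=> i si; rewrite -[E]sqr_sqrtr // -exprMn lerXn2r ?nnegrE ?normc_ge0 //.
      by rewrite mulr_ge0 ?sqrtr_ge0 // ltW.
    rewrite (le_trans (H i si)) // ler_wpM2r ?sqrtr_ge0 // ler_weXn2l //.
      by rewrite ler_pdivlMr // mul1r (le_trans d1) // ler1n.
    by rewrite (leq_trans (leq_pred _)).
  rewrite /F big_seq; apply: (@le_trans _ _ (\sum_(i <- s | i \in s) C ^+ 2 * E)).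
    by apply: ler_sum => i; exact: fC.
  rewrite -big_seq big_const_seq count_predT iter_addr_0 -[leLHS]mulr_natl mulrA ler_wpM2r //.
  by rewrite ler_wpM2r ?sqr_ge0.
have Gle (j : 'I_k) : normc (\sum_(i <- s) f i * z i ^+ j) ^+ 2 <= (k%:R + 1) ^+ 2 * F.
  have : (\sum_(i <- s) normc (f i)) ^+ 2 <= (k%:R + 1) ^+ 2 * F.
    rewrite (le_trans (sqr_sum_le _ (fun i => normc_ge0 (f i)))) // ler_wpM2r //.
    by rewrite lerXn2r ?nnegrE // ltW.
  apply: le_trans; rewrite lerXn2r ?nnegrE ?normc_ge0 ?sumr_ge0 //.
    by move=> i _; exact: normc_ge0.
  rewrite (le_trans (normc_sum _ _)) // ler_sum // => i _.
  by rewrite normcM normcX z1 expr1n mulr1.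
apply: (@le_trans _ _ (\sum_(j < k) (k%:R + 1) ^+ 2 * F)).
  by apply: ler_sum => j _; exact: Gle.
rewrite sumr_const card_ord -[leLHS]mulr_natl mulrA ler_wpM2r // exprS.
by rewrite ler_wpM2r ?sqr_ge0 // lerDl.
Qed.

End vandermonde.

(** * Separation of points differing by roots of unity *)

Section unit_circle.
Context (R : realType).
Import Normc.

(** exp(-2 pi i t): the sign is that of the conjugated character in [L2inner]. *)
Definition circle (t : R) : R[i] := Complex (cos1 t) (- sin1 t).

Lemma normc_circle t : normc (circle t) = 1.
Proof. by rewrite /= sqrrN sqr_cos1_sin1 sqrtr1. Qed.

Lemma circleX t n : circle t ^+ n = circle (n%:R * t).
Proof.
elim: n => [|n IH].
  by rewrite expr0 mul0r /circle cos1_0 sin1_0 oppr0.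
rewrite exprS IH -natr1 mulrDl mul1r addrC /circle cos1D sin1D.
by apply/eqP; rewrite eq_complex /=; apply/andP; split; apply/eqP; ring.
Qed.

Lemma sqr_normc_circleB t u :
  normc (circle t - circle u) ^+ 2 = 2 - 2 * cos1 (t - u).
Proof.
rewrite /= sqr_sqrtr ?addr_ge0 ?sqr_ge0 // cos1D cos1N sin1N.
by have := sqr_cos1_sin1 t; have := sqr_cos1_sin1 u; nra.
Qed.

Lemma cos1_lt1 (t : R) : 0 < t < 1 -> cos1 t < 1.
Proof.
move=> /andP[t0 t1]; have s0 : 0 < sin1 (t / 2) by apply: sin1_gt0; lra.
rewrite (_ : t = t / 2 + t / 2); last by field.
by rewrite cos1D; have := sqr_cos1_sin1 (t / 2); nra.
Qed.

Lemma exists_lower_bound (F : nat -> R) n : (forall i, (i < n)%N -> 0 < F i) ->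
  exists2 e : R, 0 < e <= 1 & forall i, (i < n)%N -> e <= F i.
Proof.
elim: n => [|n IH] F0; first by exists 1; rewrite ?ltr01 ?lexx.
have [e /andP[e0 e1] eF] := IH (fun i ni => F0 i (ltnW ni)).
exists (Num.min e (F n)); first by rewrite lt_min e0 F0 //= ge_min e1.
move=> i; rewrite ltnS leq_eqVlt => /predU1P[->|ni]; first by rewrite ge_min lexx orbT.
by rewrite ge_min eF.
Qed.

(** The distance depends only on r modulo n, and none of the finitely many nonzero residues gives
    distance 0, so a common lower bound exists. *)
Lemma circle_separated n : (0 < n)%N -> exists2 e : R, 0 < e <= 1 &
  forall (t : R) (r : int), ~~ (n%:Z %| r)%Z ->
    e <= normc (circle (t + r%:~R / n%:R) - circle t).
Proof.
move=> n0; have n0' : 0 < n%:R :> R by rewrite ltr0n.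
(* The residue 0 is excluded by hypothesis; the value 1 there is a positive placeholder. *)
pose F i : R := if i == 0%N then 1 else 2 - 2 * cos1 (i%:R / n%:R).
have [i ni|e /andP[e0 e1] eF] := @exists_lower_bound F n.
  rewrite /F; case: eqP => // /eqP; rewrite -lt0n => i0.
  have : cos1 (i%:R / n%:R : R) < 1; last by lra.
  by apply: cos1_lt1; rewrite divr_gt0 ?ltr0n //= ltr_pdivrMr // mul1r ltr_nat.
exists e; first by rewrite e0.
move=> t r nr; rewrite -ler_sqr ?nnegrE ?normc_ge0 ?(ltW e0) //.
rewrite sqr_normc_circleB (addrC t) addrK.
have [i [ri i0 ni]] : exists i : nat, [/\ (r %% n)%Z = i%:Z, (0 < i)%N & (i < n)%N].
  exists `|(r %% n)%Z|%N; have n0z : n%:Z != 0 by rewrite -lt0n.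
  rewrite gez0_abs ?modz_ge0 //; split => //.
    by rewrite absz_gt0; apply: contra nr => /eqP/dvdz_mod0P.
  by rewrite -ltz_nat gez0_abs ?modz_ge0 // ltz_pmod.
rewrite (_ : r%:~R / n%:R = i%:R / n%:R + (r %/ n)%Z%:~R :> R); last first.
  rewrite {1}(divz_eq r n) ri rmorphD rmorphM /=.
  by field; rewrite gt_eqF.
rewrite cos1Dz; have eFi := eF i ni; rewrite /F gtn_eqF // in eFi.
(* The bound e concerns squared distances; as e <= 1, also e^2 <= e. *)
by apply: le_trans eFi; rewrite expr2; nra.
Qed.

End unit_circle.

(** * Coordinates on the dual lattice *)

Section dual.
Context (R : realType) (d : nat) (M : 'M[R]_d).
Hypothesis uM : M \in unitmx.

Definition dual_vec (m : 'cV[int]_d) : 'cV[R]_d := (invmx M)^T *m map_mx intr m.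

Lemma innerE (x y : 'cV[R]_d) : inner x y = (x^T *m y) ord0 ord0.
Proof. by rewrite mxE; apply: eq_bigr => i _; rewrite mxE. Qed.

Lemma innerDl (x y z : 'cV[R]_d) : inner (x + y) z = inner x z + inner y z.
Proof. by rewrite -big_split; apply: eq_bigr => i _; rewrite mxE mulrDl. Qed.

Lemma innerDr (x y z : 'cV[R]_d) : inner x (y + z) = inner x y + inner x z.
Proof. by rewrite -big_split; apply: eq_bigr => i _; rewrite mxE mulrDr. Qed.

Lemma innerZl c (x y : 'cV[R]_d) : inner (c *: x) y = c * inner x y.
Proof. by rewrite mulr_sumr; apply: eq_bigr => i _; rewrite mxE mulrA. Qed.

Lemma inner_dual_vec m x : inner (dual_vec m) x = phase M m x.
Proof.
rewrite innerE trmx_mul trmxK -mulmxA mxE; apply: eq_bigr => i _.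
by rewrite !mxE /lcoord mxE.
Qed.

Lemma measurable_inner (x : 'cV[R]_d) : measurable_fun setT (inner x).
Proof.
apply: measurable_sum => i; apply: measurable_funM; first exact: measurable_cst.
exact: measurable_cV_coord.
Qed.

Lemma dual_vec_inj : injective dual_vec.
Proof.
move=> m m' /(congr1 (mulmx M^T)); rewrite !mulmxA -!trmx_mul.
rewrite mulVmx // trmx1 !mul1mx => mm; apply/matrixP => i j.
by apply: (@intr_inj R); move/matrixP/(_ i j) : mm; rewrite !mxE.
Qed.

(** The entries of M^T h are the inner products of h with the columns of M, so h is dual exactly
    when M^T h is integral. *)
Lemma dual_latticeE : dual_lattice (lattice M) = range dual_vec.
Proof.
apply/seteqP; split=> [h hP|_ [m _ <-] _ [z _ <-]]; last first.
  rewrite inner_dual_vec; apply: rpred_sum => i _.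
  by rewrite lcoord_lvec // rpredM // intr_int.
exists (\col_i Num.floor ((M^T *m h) i ord0)) => //.
have E : map_mx intr (\col_i Num.floor ((M^T *m h) i ord0)) = M^T *m h.
  apply/matrixP => i j; rewrite (ord1 j) mxE mxE floorK //.
  rewrite (_ : (M^T *m h) i ord0 = inner h (lvec M (delta_mx i ord0))).
    by apply: hP; exists (delta_mx i ord0).
  rewrite mxE; apply: eq_bigr => l _; rewrite mxE mulrC; congr (_ * _).
  rewrite mxE (bigD1 i) //= !mxE !eqxx mulr1 big1 ?addr0 // => i' ii'.
  by rewrite !mxE (negPf ii') mulr0.
by rewrite /dual_vec E mulmxA -trmx_mul mulmxV // trmx1 mul1mx.
Qed.

End dual.

(** * Finiteness of fibres *)

Section fiber.
Context (R : realType) (I : countType).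

(** An infinite A would contain k + 1 points, and these alone push the sum above k. Once A is
    finite, the sum is its cardinal. *)
Lemma esum_indic_le (A : set I) (k : nat) :
  (\esum_(i in [set: I]) (\1_A i : R)%:E <= (k%:R : R)%:E)%E ->
  exists s : seq I, [/\ uniq s, (size s <= k)%N & forall i, (i \in s) = (i \in A)].
Proof.
move=> Ak.
have fin : finite_set A.
  apply: contrapT => /(@infinite_set_fset _ _ k.+1)[B BA kB].
  move: Ak; apply/negP; rewrite -ltNge.
  have kB' : ((k%:R : R)%:E < \sum_(i <- finmap.enum_fset B) (\1_A i : R)%:E)%E.
    rewrite big_seq (eq_bigr (fun=> 1%:E)) => [|i iB]; last first.
      by rewrite indicE mem_set //; exact: BA.
    rewrite -big_seq sumEFin big_const_seq count_predT iter_addr_0 lte_fin ltr_nat.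
    exact: kB.
  apply: (lt_le_trans kB').
  apply: esum_ge; exists [set` finmap.enum_fset B]; first by split => //; exact: finite_seq.
  by rewrite -fsbig_seq //; exact: finmap.fset_uniq.
exists (finmap.enum_fset (fset_set A)).
have us : uniq (finmap.enum_fset (fset_set A)) by exact: finmap.fset_uniq.
have mem i : (i \in finmap.enum_fset (fset_set A)) = (i \in A) by exact: in_fset_set.
split => //.
move: Ak; rewrite (esum_seq us) => [|i|i]; last 2 first.
- by rewrite lee_fin indicE.
- by rewrite mem indicE => /negPf ->.
rewrite big_seq (eq_bigr (fun=> 1%:E)) => [|i]; last by rewrite mem indicE => ->.
by rewrite -big_seq sumEFin big_const_seq count_predT iter_addr_0 lee_fin ler_nat.
Qed.

End fiber.

(** * Fourier coefficients of folded functions *)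

Section fourier_coefficients.
Context (R : realType) (d : nat) (M : 'M[R]_d).
Hypothesis uM : M \in unitmx.
Local Notation X := (Rd R d).
Local Notation mu := (lebesgue R d).
Local Notation D := (fundamental_domain M : set X).
Local Notation I := 'cV[int]_d.
Local Notation mD := (measurable_fundamental_domain uM).
Local Notation finD := (fundamental_domain_lty uM).
Local Notation fold := (fold (lshift M)).

Lemma integrable_mul_bounded (u phi : X -> R) : mu.-integrable setT (EFin \o u) ->
  measurable_fun setT phi -> (forall x, `|phi x| <= 1) ->
  mu.-integrable setT (EFin \o (fun x => phi x * u x)).
Proof.
move=> iu mphi phi1.
have mu_ : measurable_fun setT u.
  by apply/measurable_EFinP; exact: measurable_int iu.
apply: (le_integrable measurableT _ _ iu).
  by apply/measurable_EFinP; exact: measurable_funM.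
by move=> x _; rewrite /= lee_fin normrM ler_piMl.
Qed.

Lemma Rintegral_mul_periodic (u phi : X -> R) : mu.-integrable setT (EFin \o u) ->
  measurable_fun setT phi -> (forall x, `|phi x| <= 1) ->
  (forall z x, phi (lshift M z x) = phi x) ->
  \int[mu]_x (phi x * u x) = ip mu D (fold u) phi.
Proof.
move=> iu mphi phi1 phiP.
have ip_ := integrable_mul_bounded iu mphi phi1.
have [_ <-] := fold_integrable (@measurable_lshift R d M) (@lebesgue_lshift R d M)
  (@opprK _) (@lshiftK R d M) mD (fundamental_domain_ex uM)
  (fundamental_domain_uniq uM) ip_.
by apply: eq_Rintegral => x _; rewrite foldM // mulrC.
Qed.

(** Since m |-> -m permutes the modes, twice each sum is the sum of its symmetrized terms. Real
    [cas] coefficients and complex ones can be compared only after m and -m are paired. *)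
Let symmetrize (S T : I -> R) :
  (forall m, 0 <= S m) -> (forall m, 0 <= T m) ->
  (forall m, T m + T (- m) = S m + S (- m)) ->
  (\esum_(m in [set: I]) (T m)%:E = \esum_(m in [set: I]) (S m)%:E)%E.
Proof.
move=> S0 T0 TS.
have dbl (F : I -> R) : (forall m, 0 <= F m) ->
    (\esum_(m in [set: I]) (F m + F (- m))%:E =
     2%:E * \esum_(m in [set: I]) (F m)%:E)%E.
  move=> F0; under eq_esum do rewrite EFinD.
  rewrite esumD; try by move=> m _; rewrite lee_fin.
  rewrite -[X in (_ + X)%E](@reindex_esum _ _ _ setT setT -%R (fun m => (F m)%:E)).
    by rewrite -mule2n -mule_natl.
  by split => [|i j _ _ /oppr_inj|i _] //; exists (- i) => //; exact: opprK.
have : (2%:E * (\esum_(m in [set: I]) (T m)%:E) =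
        2%:E * (\esum_(m in [set: I]) (S m)%:E))%E.
  by rewrite -!dbl //; apply: eq_esum => m _; rewrite TS.
move=> /(congr1 (fun e => (2^-1)%:E * e)%E).
by rewrite !muleA -!EFinM mulVf // !mul1e.
Qed.

Hypothesis D0 : 0 < fine (mu D).

(** The summand is the squared modulus of the coefficient of p + i q against the exponential of mode
    m. Adding the terms at m and -m cancels all cross products of cosine and sine integrals, which
    leaves the same total as for the [cas] coefficients of p and q; to these the real Parseval
    identity applies. *)
Lemma esum_fourier (p q : X -> R) :
  mu.-integrable setT (EFin \o p) -> mu.-integrable setT (EFin \o q) ->
  square_integrable mu D (fold p) -> square_integrable mu D (fold q) ->
  (\esum_(m in [set: I])
     ((\int[mu]_x (cosp M m x * p x) + \int[mu]_x (sinp M m x * q x)) ^+ 2 +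
      (\int[mu]_x (cosp M m x * q x) - \int[mu]_x (sinp M m x * p x)) ^+ 2)%:E =
   (fine (mu D))%:E * \int[mu]_(x in D) (fold p x ^+ 2 + fold q x ^+ 2)%:E)%E.
Proof.
move=> iP iQ sP sQ.
have [mP2 iP2] := sP; have [mQ2 iQ2] := sQ.
pose cs (u : X -> R) m := ip mu D (fold u) (cas M m).
pose C (u : X -> R) m := \int[mu]_x (cosp M m x * u x).
pose S (u : X -> R) m := \int[mu]_x (sinp M m x * u x).
have casE u m : mu.-integrable setT (EFin \o u) -> square_integrable mu D (fold u) ->
    cs u m = C u m + S u m.
  move=> iu su; rewrite /C /S !Rintegral_mul_periodic //; first last.
  - exact: cosp_lshift.
  - by move=> x; exact: cos1_le1.
  - exact: measurable_cosp.
  - exact: sinp_lshift.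
  - by move=> x; exact: sin1_le1.
  - exact: measurable_sinp.
  rewrite /cs ipC ipD; [by rewrite !(ipC _ _ (fold u))|exact: mD| | |exact: su].
    apply: (square_integrable_bounded mD finD) (fun x => cos1_le1 _).
    exact: measurable_funTS (measurable_cosp M m).
  apply: (square_integrable_bounded mD finD) (fun x => sin1_le1 _).
  exact: measurable_funTS (measurable_sinp M m).
have CN u m : C u (- m) = C u m.
  by apply: eq_Rintegral => x _; rewrite /cosp phaseN cos1N.
have SN u m : mu.-integrable setT (EFin \o u) -> S u (- m) = - S u m.
  move=> iu; rewrite -[RHS]mulN1r -RintegralZl //.
    by apply: eq_Rintegral => x _; rewrite /sinp phaseN sin1N; ring.
  apply: integrable_mul_bounded => // [|x]; first exact: measurable_sinp.
  exact: sin1_le1.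
rewrite (@symmetrize (fun m => cs p m ^+ 2 + cs q m ^+ 2)).
- under eq_esum do rewrite EFinD.
  rewrite esumD; try by move=> m _; rewrite lee_fin sqr_ge0.
  rewrite !parseval_cas //; under [in RHS]eq_integral do rewrite EFinD.
  have sq0 (u : X -> R) x : D x -> (0 <= (u x ^+ 2)%:E)%E.
    by move=> _; rewrite lee_fin sqr_ge0.
  have msq (u : X -> R) : measurable_fun D u -> measurable_fun D (fun x => (u x ^+ 2)%:E).
    by move=> mu_; apply/measurable_EFinP; exact: measurable_funX.
  have int0 (u : X -> R) : (0 <= \int[mu]_(x in D) (u x ^+ 2)%:E)%E.
    by apply: integral_ge0; exact: sq0.
  rewrite (ge0_integralD _ mD (@sq0 _) (msq _ mP2) (@sq0 _) (msq _ mQ2)).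
  by rewrite (ge0_muleDr _ (int0 _) (int0 _)).
- by move=> m; rewrite addr_ge0 ?sqr_ge0.
- by move=> m; rewrite addr_ge0 ?sqr_ge0.
move=> m; rewrite !casE // -/(C p m) -/(C q m) -/(S p m) -/(S q m).
rewrite -/(C p (- m)) -/(C q (- m)) -/(S p (- m)) -/(S q (- m)).
by rewrite !CN !SN //; ring.
Qed.

End fourier_coefficients.

Lemma esum_range_prod (R : realType) (I : countType) (J : choiceType) k (e : I -> J)
    (F : J * 'I_k -> \bar R) : injective e -> (forall t, 0 <= F t)%E ->
  (\esum_(t in range e `*` setT) F t =
   \sum_(j < k) \esum_(m in [set: I]) F (e m, j))%E.
Proof.
move=> e_inj F0; rewrite -esum_sum //.
rewrite (eq_esum (b := fun m => \esum_(j in [set: 'I_k]) F (e m, j))%E); last first.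
  move=> m _; rewrite (@esum_seq R _ _ (index_enum 'I_k)) //; first exact: index_enum_uniq.
  by move=> j; rewrite mem_index_enum.
rewrite esum_esum //.
rewrite (@reindex_esum _ _ _ (setT `*`` fun=> setT) _ (fun t => (e t.1, t.2))) //.
split => [[m j] _ /=|[m j] [m' j'] _ _ /= [/e_inj -> ->]|[y j] [[m _ /= <-] _]] //.
  by split => //; exists m.
by exists (m, j).
Qed.

(** * Fibres of Omega over the fundamental domain *)

Section fiber_frame.
Context (R : realType) (d k : nat) (M : 'M[R]_d).
Hypothesis uM : M \in unitmx.
Local Notation X := (Rd R d).
Local Notation mu := (lebesgue R d).
Local Notation D := (fundamental_domain M : set X).
Local Notation I := 'cV[int]_d.
Local Notation mD := (measurable_fundamental_domain uM).
Local Notation fold := (fold (lshift M)).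
Import Normc.
Variable Omega : set X.
Hypothesis mOmega : measurable Omega.
Hypothesis tiles : submulti_tiles M Omega k.
Variables (v : 'cV[R]_d) (n : nat).
Hypothesis dual_v : dual_lattice (lattice M) v.
Hypothesis n0 : (0 < n)%N.
Hypothesis sep_v : {ae mu, forall w, D w -> forall l l',
  lattice_fiber (lattice M) Omega w l -> lattice_fiber (lattice M) Omega w l' ->
  l <> l' -> forall p q : int, inner v l = p%:~R -> inner v l' = q%:~R ->
  (p <> q %[mod n%:Z])%Z}.

Lemma integral_lattice_fold (U : X -> \bar R) : measurable_fun setT U ->
  (forall x, 0 <= U x)%E ->
  (\int[mu]_x U x = \int[mu]_(x in D) (\esum_(z in setT) U (lshift M z x)))%E.
Proof.
exact: (integral_fold (@measurable_lshift R d M) (@lebesgue_lshift R d M)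
  (@opprK _) (@lshiftK R d M) mD (fundamental_domain_ex uM)
  (fundamental_domain_uniq uM)).
Qed.

Lemma measurable_lattice_esum (U : X -> \bar R) : measurable_fun setT U ->
  (forall x, 0 <= U x)%E ->
  measurable_fun D (fun x => \esum_(z in setT) U (lshift M z x))%E.
Proof.
move=> mU U0; apply: measurable_fun_esum => [z|//]; apply: measurable_funTS.
exact: (measurableT_comp mU (measurable_lshift M z)).
Qed.

(** If D were null, folding the indicator of [Omega] onto it would give [Omega] measure 0.
    Positivity of |D| is needed since it is a factor of the frame bounds. *)
Lemma fundamental_domain_gt0 : (0 < mu Omega)%E -> (0 < mu D)%E.
Proof.
move=> O0; rewrite lt0e measure_ge0 andbT; apply/negP => /eqP D0.
have mU : measurable_fun setT (fun x : X => (\1_Omega x : R)%:E).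
  exact/measurable_EFinP.
have U0 x : (0 <= (\1_Omega x : R)%:E)%E by rewrite lee_fin.
have E : (\int[mu]_x (\1_Omega x)%:E = 0)%E.
  rewrite integral_lattice_fold; [|exact: mU|exact: U0].
  exact: (null_set_integral mD (measurable_lattice_esum mU U0) D0).
by move: O0; rewrite -(setIT Omega) -integral_indic // E ltxx.
Qed.

Definition unit_root (x : X) : R[i] := circle (inner v x / n%:R).

(** The gap e is chosen before x and depends on n alone. Over one x, two values of [unit_root]
    differ by the factor exp(-2 pi i (p - q) / n), where p - q is not divisible by n by
    admissibility; the list s enumerates the fibre. *)
Lemma ae_fiber : exists2 e : R, 0 < e <= 1 & {ae mu, forall x, D x ->
  exists s : seq I, [/\ uniq s, (size s <= k)%N,
    forall z, z \notin s -> ~ Omega (lshift M z x) &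
    {in s &, forall z w, z != w ->
      e <= normc (unit_root (lshift M z x) - unit_root (lshift M w x))}]}.
Proof.
have [e e01 eP] := @circle_separated R n n0; exists e => //.
apply: (filterS2 (F := almost_everywhere mu)) tiles sep_v => x Tx Sx Dx.
have := Tx Dx; rewrite latticeE (@reindex_esum _ _ _ setT _ (@lvec R d M)); last first.
  by apply: inj_bij => z w _ _; exact: lvec_inj.
move=> /(@esum_indic_le R I [set z | Omega (lshift M z x)] k)[s [us sk sP]].
exists s; split => // [z|z w].
  by rewrite sP notin_setE.
rewrite !sP !inE => Oz Ow zw.
have intv y : exists r : int, inner v (lvec M y) = r%:~R.
  have /intrP[r ->] : inner v (lvec M y) \is a Num.int by apply: dual_v; exists y.
  by exists r.
have [[p pE] [q qE]] := (intv z, intv w).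
have pq : ~~ (n%:Z %| p - q)%Z.
  rewrite -eqz_mod_dvd; apply/eqP; apply: (Sx Dx (lvec M z) (lvec M w)) => //.
  - by split => //; exists z.
  - by split => //; exists w.
  - by move/(lvec_inj uM) => zw'; rewrite zw' eqxx in zw.
have := eP (inner v (lshift M w x) / n%:R) (p - q) pq.
rewrite /unit_root; congr (_ <= normc (circle _ - _)).
by rewrite -mulrDl !innerDr pE qE rmorphB /=; congr (_ / _); ring.
Qed.

End fiber_frame.

(** * Energy of the modulations, on a fibre and over the fundamental domain *)

Section frame_bounds.
Context (R : realType) (d k : nat) (M : 'M[R]_d).
Hypothesis uM : M \in unitmx.
Local Notation X := (Rd R d).
Local Notation mu := (lebesgue R d).
Local Notation D := (fundamental_domain M : set X).
Local Notation I := 'cV[int]_d.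
Local Notation mD := (measurable_fundamental_domain uM).
Local Notation fold := (fold (lshift M)).
Import Normc.
Variables (Omega : set X) (t : X -> R) (e : R).
Hypothesis mt : measurable_fun setT t.
Hypothesis e01 : 0 < e <= 1.
Hypothesis fib : {ae mu, forall x, D x ->
  exists s : seq I, [/\ uniq s, (size s <= k)%N,
    forall z, z \notin s -> ~ Omega (lshift M z x) &
    {in s &, forall z w, z != w ->
      e <= normc (circle (t (lshift M z x)) - circle (t (lshift M w x)))}]}.

Lemma sqr_normc (x : R[i]) : normc x ^+ 2 = complex.Re x ^+ 2 + complex.Im x ^+ 2.
Proof. by case: x => a b /=; rewrite sqr_sqrtr // addr_ge0 ?sqr_ge0. Qed.

Definition modulation (g : X -> R[i]) (j : nat) (x : X) : R[i] :=
  g x * circle (j%:R * t x).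

(** The squared modulus of the fibre sum F_j; real and imaginary parts are folded separately because
    [fold] is real valued. *)
Definition modulation_energy (g : X -> R[i]) (j : nat) (x : X) : R :=
  fold (fun y => complex.Re (modulation g j y)) x ^+ 2 +
  fold (fun y => complex.Im (modulation g j y)) x ^+ 2.

(** Over almost every x the fibre is finite, so each fold is a finite sum and the Vandermonde bounds
    apply with coefficients [g] on the fibre. A and B are fixed before [g]. *)
Lemma fiber_energy_bounds : exists A B : R, [/\ 0 < A, 0 < B &
  forall g : X -> R[i], (forall x, ~ Omega x -> g x = 0) ->
  {ae mu, forall x, D x ->
    (A%:E * (\esum_(z in [set: I]) (normc (g (lshift M z x)) ^+ 2)%:E) <=
      (\sum_(j < k) modulation_energy g j x)%:E <=
    B%:E * \esum_(z in [set: I]) (normc (g (lshift M z x)) ^+ 2)%:E)%E}].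
Proof.
have [A [B [A0 B0 AB]]] := @vandermonde_frame R k e e01.
exists A, B; split => //; move=> g gO.
apply: (filterS (F := almost_everywhere mu)) fib => x xs /xs[s [us sk sO sep]].
have gs z : z \notin s -> g (lshift M z x) = 0 by move=> /sO; exact: gO.
rewrite (esum_seq us); last 2 first.
- by move=> z; rewrite lee_fin sqr_ge0.
- by move=> z /gs ->; rewrite normc0 expr0n.
rewrite sumEFin -!EFinM !lee_fin.
have := AB _ s (fun z => circle (t (lshift M z x))) (fun z => g (lshift M z x))
  us sk (fun z => normc_circle _) sep.
set S := \sum_(j < k) _; set S' := \sum_(j < k) _; suff -> : S = S' by [].
apply: eq_bigr => j _; rewrite sqr_normc /modulation_energy.
rewrite !(fold_seq us); try by move=> z /gs E; rewrite /modulation E mul0r.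
rewrite (big_morph (@complex.Re R) (id1 := 0) (op1 := +%R)) //; last by case=> ? ? [].
rewrite (big_morph (@complex.Im R) (id1 := 0) (op1 := +%R)) //; last by case=> ? ? [].
by congr (_ ^+ 2 + _ ^+ 2); apply: eq_bigr => z _; rewrite circleX.
Qed.

Lemma measurable_modulation g j :
  measurable_fun setT (fun x => complex.Re (g x)) ->
  measurable_fun setT (fun x => complex.Im (g x)) ->
  measurable_fun setT (fun x => complex.Re (modulation g j x)) /\
  measurable_fun setT (fun x => complex.Im (modulation g j x)).
Proof.
move=> mr mi.
have mjt : measurable_fun setT (fun x : X => j%:R * t x).
  by apply: measurable_funM => //; exact: measurable_cst.
have mc := measurableT_comp (@measurable_cos1 R) mjt.
have ms := measurableT_comp (@measurable_sin1 R) mjt.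
split.
  rewrite (_ : (fun x => _) = fun x => complex.Re (g x) * cos1 (j%:R * t x) +
      complex.Im (g x) * sin1 (j%:R * t x)).
    by apply: measurable_funD; exact: measurable_funM.
  by apply/funext => x; rewrite /modulation; case: (g x) => a b /=; ring.
rewrite (_ : (fun x => _) = fun x => complex.Im (g x) * cos1 (j%:R * t x) -
    complex.Re (g x) * sin1 (j%:R * t x)).
  by apply: measurable_funB; exact: measurable_funM.
by apply/funext => x; rewrite /modulation; case: (g x) => a b /=; ring.
Qed.

Lemma measurable_modulation_energy g j :
  measurable_fun setT (fun x => complex.Re (g x)) ->
  measurable_fun setT (fun x => complex.Im (g x)) ->
  measurable_fun setT (modulation_energy g j).
Proof.
move=> mr mi; have [mp mq] := measurable_modulation j mr mi.
by apply: measurable_funD; apply: measurable_funX;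
  apply: (measurable_fold (@measurable_lshift R d M)).
Qed.

(** The fibrewise inequalities are integrated over D, where the outer terms unfold to the integral
    over the whole space. *)
Lemma energy_bounds : exists A B : R, [/\ 0 < A, 0 < B &
  forall g : X -> R[i], (forall x, ~ Omega x -> g x = 0) ->
  measurable_fun setT (fun x => complex.Re (g x)) ->
  measurable_fun setT (fun x => complex.Im (g x)) ->
  (A%:E * (\int[mu]_x (normc (g x) ^+ 2)%:E) <=
    (\sum_(j < k) \int[mu]_(x in D) (modulation_energy g j x)%:E) <=
  B%:E * \int[mu]_x (normc (g x) ^+ 2)%:E)%E].
Proof.
have [A [B [A0 B0 AB]]] := fiber_energy_bounds.
exists A, B; split => //; move=> g gO mr mi.
have e0 j x : 0 <= modulation_energy g j x by rewrite addr_ge0 ?sqr_ge0.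
have me j := measurable_modulation_energy j mr mi.
have mN : measurable_fun setT (fun x => (normc (g x) ^+ 2)%:E).
  apply/measurable_EFinP; under eq_fun do rewrite sqr_normc.
  by apply: measurable_funD; exact: measurable_funX.
have N0 x : (0 <= (normc (g x) ^+ 2)%:E)%E by rewrite lee_fin sqr_ge0.
rewrite -ge0_integral_sum; [|exact: mD| |by move=> j x _; rewrite lee_fin]; last first.
  by move=> j; apply/measurable_EFinP; exact: measurable_funTS.
under [X in (_ <= X <= _)%E]eq_integral do rewrite sumEFin.
rewrite (integral_lattice_fold uM mN N0).
have mL := measurable_lattice_esum (M := M) mN N0.
have L0 x : D x -> (0 <= \esum_(z in [set: I]) (normc (g (lshift M z x)) ^+ 2)%:E)%E.
  by move=> _; apply: esum_ge0.
have mS : measurable_fun D (fun x => (\sum_(j < k) modulation_energy g j x)%:E).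
  apply/measurable_EFinP; apply: measurable_sum => j; exact: measurable_funTS.
have S0 x : D x -> (0 <= (\sum_(j < k) modulation_energy g j x)%:E)%E.
  by move=> _; rewrite lee_fin sumr_ge0.
have cL (c : R) : 0 < c ->
    [/\ (c%:E * (\int[mu]_(x in D) (\esum_(z in [set: I]) (normc (g (lshift M z x)) ^+ 2)%:E)) =
      \int[mu]_(x in D) (c%:E * (\esum_(z in [set: I]) (normc (g (lshift M z x)) ^+ 2)%:E)))%E,
     measurable_fun D
       (fun x => c%:E * \esum_(z in [set: I]) (normc (g (lshift M z x)) ^+ 2)%:E)%E &
     forall x, D x ->
       (0 <= c%:E * \esum_(z in [set: I]) (normc (g (lshift M z x)) ^+ 2)%:E)%E].
  move=> c0; split.
  - by rewrite ge0_integralZl_EFin //; [exact: mD|exact: ltW].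
  - exact: measurable_funeM.
  - by move=> x Dx; rewrite mule_ge0 ?L0 // lee_fin ltW.
have [EA mA pA] := cL A A0; have [EB mB pB] := cL B B0.
rewrite EA EB; apply/andP; split.
  apply: (ae_ge0_le_integral mD pA mA S0 mS).
  by apply: (filterS (F := almost_everywhere mu)) (AB g gO) => x H /H /andP[].
apply: (ae_ge0_le_integral mD S0 mS pB mB).
by apply: (filterS (F := almost_everywhere mu)) (AB g gO) => x H /H /andP[].
Qed.

End frame_bounds.

(** * Frame coefficients as Fourier coefficients of modulations *)

Section frame_of_exponentials.
Context (R : realType) (d k : nat) (M : 'M[R]_d).
Hypothesis uM : M \in unitmx.
Local Notation X := (Rd R d).
Local Notation mu := (lebesgue R d).
Local Notation D := (fundamental_domain M : set X).
Local Notation I := 'cV[int]_d.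
Local Notation mD := (measurable_fundamental_domain uM).
Local Notation fold := (fold (lshift M)).
Import Normc.
Variable Omega : set X.
Hypothesis mOmega : measurable Omega.
Hypothesis finOmega : (mu Omega < +oo)%E.

(** On [Omega] write u as u times 1: both factors are square integrable because [Omega] has finite
    measure. *)
Lemma integrable_of_square (u : X -> R) : measurable_fun setT u ->
  (forall x, ~ Omega x -> u x = 0) ->
  (\int[mu]_x ((u x) ^+ 2)%:E < +oo)%E -> mu.-integrable setT (EFin \o u).
Proof.
move=> mu_ uO u2.
have su : square_integrable mu Omega u.
  apply: square_integrableP; first exact: measurable_funTS.
  apply: le_lt_trans u2.
  apply: (@ge0_subset_integral _ _ _ mu _ _ mOmega measurableT).
  - by apply/measurable_EFinP; exact: measurable_funX.
  - by move=> x _; rewrite lee_fin sqr_ge0.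
  - by [].
have s1 : square_integrable mu Omega (fun=> 1).
  by apply: (square_integrable_bounded (K := 1) mOmega finOmega) => // x; rewrite normr1.
have := integrable_mul mOmega su s1.
move=> /(integrable_mkcond _ mOmega).
apply: eq_integrable => // x _; rewrite patchE /=.
case: ifPn => [_|]; first by rewrite mulr1.
by rewrite notin_setE => /uO ->.
Qed.

Variable t : X -> R.
Hypothesis mt : measurable_fun setT t.
Variable f : X -> R[i].
Hypothesis fL2 : L2 Omega f.

(** A representative of an element of L^2(Omega) is arbitrary outside [Omega], whereas folding reads
    its values on all of R^d. *)
Definition zero_ext (x : X) : R[i] := if x \in Omega then f x else 0.

Lemma zero_ext_out x : ~ Omega x -> zero_ext x = 0.
Proof. by move=> xO; rewrite /zero_ext ifN // notin_setE. Qed.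

Lemma measurable_zero_ext :
  measurable_fun setT (fun x => complex.Re (zero_ext x)) /\
  measurable_fun setT (fun x => complex.Im (zero_ext x)).
Proof.
have [mr mi _] := fL2; split.
  rewrite (_ : (fun x => _) = (fun x => complex.Re (f x)) \_ Omega).
    exact/(measurable_restrictT _ mOmega).
  by apply/funext => x; rewrite patchE /zero_ext; case: ifP.
rewrite (_ : (fun x => _) = (fun x => complex.Im (f x)) \_ Omega).
  exact/(measurable_restrictT _ mOmega).
by apply/funext => x; rewrite patchE /zero_ext; case: ifP.
Qed.

Lemma L2norm2_zero_ext :
  L2norm2 Omega f = (\int[mu]_x (normc (zero_ext x) ^+ 2)%:E)%E.
Proof.
rewrite /L2norm2 integral_mkcond; apply: eq_integral => x _.
by rewrite patchE /zero_ext; case: ifP => // _; rewrite normc0 expr0n.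
Qed.

Local Notation p j := (fun x => complex.Re (modulation t zero_ext j x)).
Local Notation q j := (fun x => complex.Im (modulation t zero_ext j x)).

Lemma integrable_modulation j :
  mu.-integrable setT (EFin \o p j) /\ mu.-integrable setT (EFin \o q j).
Proof.
have [mr mi] := measurable_zero_ext; have [mp mq] := measurable_modulation mt j mr mi.
have [_ _ fin] := fL2; rewrite -/(L2norm2 Omega f) L2norm2_zero_ext in fin.
have out x : ~ Omega x -> modulation t zero_ext j x = 0.
  by move=> xO; rewrite /modulation zero_ext_out // mul0r.
have E x : normc (zero_ext x) ^+ 2 = p j x ^+ 2 + q j x ^+ 2.
  by rewrite -sqr_normc /modulation normcM normc_circle mulr1.
have sq (u : X -> R) : measurable_fun setT u ->
    measurable_fun setT (fun x => (u x ^+ 2)%:E).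
  by move=> mu_; apply/measurable_EFinP; exact: measurable_funX.
have mN : measurable_fun setT (fun x => (normc (zero_ext x) ^+ 2)%:E).
  under eq_fun do rewrite E EFinD; by apply: emeasurable_funD; exact: sq.
have sq0 (r : R) : (0 <= (r ^+ 2)%:E)%E by rewrite lee_fin sqr_ge0.
have small (u : X -> R) : measurable_fun setT u ->
    (forall x, u x ^+ 2 <= normc (zero_ext x) ^+ 2) ->
    (forall x, ~ Omega x -> u x = 0) -> mu.-integrable setT (EFin \o u).
  move=> mu_ le uO; apply: integrable_of_square => //.
  apply: le_lt_trans fin.
  apply: ge0_le_integral; first exact: measurableT.
  - by move=> x _; exact: sq0.
  - exact: sq.
  - exact: mN.
  - by move=> x _; rewrite lee_fin.
split; apply: small; [exact: mp| | |exact: mq| |].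
- by move=> x; rewrite E lerDl sqr_ge0.
- by move=> x /out ->.
- by move=> x; rewrite E lerDr sqr_ge0.
- by move=> x /out ->.
Qed.

(** The phase of the character splits as j t plus the phase of mode m. The first part is absorbed
    into the modulation; the second is lattice periodic up to integers and so passes through the
    fold. *)
Lemma sqr_L2inner_character (a : 'cV[R]_d) (m : I) j :
  (forall x, inner a x = j%:R * t x) ->
  normc (L2inner Omega f (character (a + dual_vec M m))) ^+ 2 =
  (\int[mu]_x (cosp M m x * p j x) + \int[mu]_x (sinp M m x * q j x)) ^+ 2 +
  (\int[mu]_x (cosp M m x * q j x) - \int[mu]_x (sinp M m x * p j x)) ^+ 2.
Proof.
move=> at_; have [ip_ iq] := integrable_modulation j.
have ic (u : X -> R) : mu.-integrable setT (EFin \o u) ->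
    mu.-integrable setT (EFin \o (fun x => cosp M m x * u x)).
  move=> iu; apply: integrable_mul_bounded => // [|x]; first exact: measurable_cosp.
  exact: cos1_le1.
have is_ (u : X -> R) : mu.-integrable setT (EFin \o u) ->
    mu.-integrable setT (EFin \o (fun x => sinp M m x * u x)).
  move=> iu; apply: integrable_mul_bounded => // [|x]; first exact: measurable_sinp.
  exact: sin1_le1.
have charE x : character (a + dual_vec M m) x =
    Complex (cos1 (j%:R * t x + phase M m x)) (sin1 (j%:R * t x + phase M m x)).
  by rewrite /character innerDl at_ inner_dual_vec.
have ReE : complex.Re (L2inner Omega f (character (a + dual_vec M m))) =
    \int[mu]_x (cosp M m x * p j x + sinp M m x * q j x).
  transitivity (\int[mu]_(x in Omega)
      complex.Re (f x * conjc (character (a + dual_vec M m) x))); first by [].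
  rewrite Rintegral_mkcond; apply: eq_Rintegral => x _.
  rewrite patchE charE /modulation /zero_ext; case: ifP => _.
    by rewrite /cosp /sinp; case: (f x) => b c /=; rewrite cos1D sin1D; ring.
  by rewrite mul0r /= !mulr0 addr0.
have ImE : complex.Im (L2inner Omega f (character (a + dual_vec M m))) =
    \int[mu]_x (cosp M m x * q j x - sinp M m x * p j x).
  transitivity (\int[mu]_(x in Omega)
      complex.Im (f x * conjc (character (a + dual_vec M m) x))); first by [].
  rewrite Rintegral_mkcond; apply: eq_Rintegral => x _.
  rewrite patchE charE /modulation /zero_ext; case: ifP => _.
    by rewrite /cosp /sinp; case: (f x) => b c /=; rewrite cos1D sin1D; ring.
  by rewrite mul0r /= !mulr0 subr0.
rewrite sqr_normc ReE ImE.
have icp := ic _ ip_; have icq := ic _ iq; have isp := is_ _ ip_; have isq := is_ _ iq.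
rewrite (RintegralD measurableT icp isq).
by rewrite (RintegralB measurableT icq isp).
Qed.

(** Finite energy makes the folds of the real and imaginary parts square integrable on D, which
    Parseval demands. *)
Lemma esum_modulation j : 0 < fine (mu D) ->
  (\int[mu]_(x in D) (modulation_energy M t zero_ext j x)%:E < +oo)%E ->
  (\esum_(m in [set: I])
     ((\int[mu]_x (cosp M m x * p j x) + \int[mu]_x (sinp M m x * q j x)) ^+ 2 +
      (\int[mu]_x (cosp M m x * q j x) - \int[mu]_x (sinp M m x * p j x)) ^+ 2)%:E =
   (fine (mu D))%:E * \int[mu]_(x in D) (modulation_energy M t zero_ext j x)%:E)%E.
Proof.
move=> D0 fin; have [ip_ iq] := integrable_modulation j.
have [mr mi] := measurable_zero_ext; have [mp mq] := measurable_modulation mt j mr mi.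
have me := measurable_modulation_energy M mt j mr mi.
have sq (u : X -> R) : measurable_fun setT u ->
    (forall x, fold u x ^+ 2 <= modulation_energy M t zero_ext j x) ->
    square_integrable mu D (fold u).
  move=> mu_ le; have mf := measurable_fold (@measurable_lshift R d M) mu_.
  apply: square_integrableP; first exact: measurable_funTS.
  apply: le_lt_trans fin; apply: ge0_le_integral; first exact: mD.
  - by move=> x _; rewrite lee_fin sqr_ge0.
  - by apply/measurable_EFinP; apply: measurable_funX; exact: measurable_funTS.
  - by apply/measurable_EFinP; exact: measurable_funTS.
  - by move=> x _; rewrite lee_fin.
rewrite (esum_fourier uM D0 ip_ iq) //; apply: sq => // x.
  by rewrite lerDl sqr_ge0.
by rewrite lerDr sqr_ge0.
Qed.

End frame_of_exponentials.

Theorem theorem4p2 (R : realType) (d k : nat) (M : 'M[R]_d)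
    (Omega : set 'cV[R]_d) :
  M \in unitmx ->
  (0 < k)%N ->
  lebesgue_measurable Omega ->
  (0 < lebesgue R d Omega < +oo)%E ->
  submulti_tiles M Omega k ->
  admissible M Omega ->
  exists a : 'I_k -> 'cV[R]_d,
    is_frame Omega (dual_lattice (lattice M) `*` [set: 'I_k]) (exp_system a).
Proof.
move=> uM k0 mO /andP[vol_gt0 finO] tiles [v [n [dual_v n0 sep_v]]].
have mOmega : measurable (Omega : set (Rd R d)) := mO.
have [e e01 fib] := ae_fiber uM tiles dual_v n0 sep_v.
pose t : Rd R d -> R := fun x => inner v x / n%:R.
have mt : measurable_fun setT t.
  apply: measurable_funM; last exact: measurable_cst.
  exact: measurable_Rd (measurable_inner v).
have [A [B [A0 B0 AB]]] := energy_bounds uM mt e01 fib.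
have D0 : 0 < fine (lebesgue R d (fundamental_domain M)).
  apply: fine_gt0; rewrite fundamental_domain_lty // andbT.
  exact: (fundamental_domain_gt0 uM mOmega vol_gt0).
set c := fine _ in D0.
(* j starts at 0, matching the exponents 0, ..., k - 1 of the Vandermonde sums. *)
pose a (j : 'I_k) : 'cV[R]_d := (j%:R / n%:R) *: v.
have at_ j x : inner (a j) x = j%:R * t x by rewrite innerZl /t mulrAC mulrA.
have H0 := dual_latticeE uM.
have mphi b : measurable_fun setT (fun x : Rd R d => inner b x).
  exact: measurable_Rd (measurable_inner b).
exists a; split.
- rewrite H0; apply: countableX; last exact: countableP.
  exact: sub_countable (card_image_le _ _) (countableP _).
- case=> h j _; rewrite /exp_system /=; split.
  + apply: measurable_funTS.
    exact: (measurableT_comp (@measurable_cos1 R) (mphi _)).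
  + apply: measurable_funTS.
    exact: (measurableT_comp (@measurable_sin1 R) (mphi _)).
  + under eq_integral do rewrite sqr_normc /= sqr_cos1_sin1.
    by rewrite integral_cst // mul1e.
(* A and B compare the energies with the norm of f; c = |D| is the factor in Parseval, the squared
   norm of a mode on D. *)
exists (A * c), (B * c); split; [exact: mulr_gt0|exact: mulr_gt0|].
move=> f fL2; have [mr mi] := measurable_zero_ext mOmega fL2.
have := AB _ (fun x => @zero_ext_out R d Omega f x) mr mi.
rewrite -(L2norm2_zero_ext Omega f) H0 esum_range_prod; last 2 first.
- exact: dual_vec_inj.
- by move=> hj; rewrite lee_fin sqr_ge0.
move=> bnd.
have e0 j : (0 <= \int[lebesgue R d]_(x in fundamental_domain M)
    (modulation_energy M t (zero_ext Omega f) j x)%:E)%E.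
  by apply: integral_ge0 => x _; rewrite lee_fin addr_ge0 ?sqr_ge0.
(* Each energy is one nonnegative term of a sum that the upper bound controls by the finite norm of
   f. *)
have efin (j : 'I_k) : (\int[lebesgue R d]_(x in fundamental_domain M)
    (modulation_energy M t (zero_ext Omega f) j x)%:E < +oo)%E.
  have /andP[_ ub] := bnd; have [_ _ ffin] := fL2.
  apply: (@le_lt_trans _ _ (B%:E * L2norm2 Omega f)%E).
    apply: le_trans ub; rewrite (bigD1 j) //= leeDl // sume_ge0 //.
  rewrite lte_mul_pinfty ?lee_fin //; exact: ltW.
rewrite (eq_bigr (fun j : 'I_k => (c%:E * \int[lebesgue R d]_(x in fundamental_domain M)
    (modulation_energy M t (zero_ext Omega f) j x)%:E)%E)); last first.
  move=> j _; rewrite -(esum_modulation uM mOmega finO mt fL2 D0 (efin j)).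
  apply: eq_esum => m _.
  by rewrite -(sqr_L2inner_character M mOmega finO mt fL2 (a := a j)).
rewrite -ge0_sume_distrr; last by move=> j _; exact: e0.
have cge0 : (0 <= c%:E)%E by rewrite lee_fin ltW.
move: bnd => /andP[lb ub]; apply/andP; split.
  by rewrite mulrC EFinM -muleA lee_wpmul2l.
by rewrite (mulrC B) EFinM -muleA lee_wpmul2l.
Qed.
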